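(* The problem ML-CAP-STEINER-TREE (in undirected graphs and in directed graphs), restricted to instances in which $c(e)=1$ for all $e\in E$, is solvable in polynomial time.
   Context: Graphs $G=(V,E)$ are finite and may be directed or undirected. ML-CAP-STEINER-TREE. Input: a connected graph $G=(V,E)$; a set $T\subset V$ of $K\ge 2$ terminals; a root $r\in V\setminus T$ (if $G$ is directed, there is a directed path from $r$ to every vertex of $V$); a nonnegative rational length $\ell(e)$ and a positive integer capacity $c(e)$ for every $e\in E$. Objective: determine, if one exists, a tree $S$ in $G$, directed away from its root $r$, that spans all vertices of $T$ (it need not span $V$), satisfies the capacity constraints, and has minimum total length. The capacity constraints say: for every arc $e=(u,v)$ of $S$, the subtree of $S$ rooted at $v$ contains at most $c(e)$ terminals. If $G$ is undirected, an arc $(u,v)$ of $S$ must be such that $[u,v]\in E$, and it has the length and capacity of that edge. *)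

(* Defs.v *)
From HB Require Import structures.
From mathcomp Require Import all_boot all_order all_algebra.
Set Implicit Arguments.
Unset Strict Implicit.
Unset Printing Implicit Defensive.
Import Order.TTheory GRing.Theory Num.Theory.

(* Model of computation: the WHILE language over binary trees of N. D. Jones
   (Computability and Complexity from a Programming Perspective, 1997).
   Jones charges unit cost per operation and shares subtrees; here every
   evaluated subexpression is charged the full size of its value instead, so
   that data cannot be copied for free, the size of every value ever built is
   bounded by the running time plus the input size, and this model and
   multitape Turing machines simulate each other with polynomial overhead. *)

Inductive tree : Type := Leaf | Node of tree & tree.

Fixpoint tsize (t : tree) : nat :=
  if t is Node a b then (tsize a + tsize b).+1 else 1.

Definition is_node (t : tree) : bool := if t is Node _ _ then true else false.
Definition thead (t : tree) : tree := if t is Node a _ then a else Leaf.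
Definition ttail (t : tree) : tree := if t is Node _ b then b else Leaf.

Inductive expr : Type :=
  | EVar of nat
  | ELeaf
  | ENode of expr & expr
  | EHead of expr
  | ETail of expr.

Inductive cmd : Type :=
  | Skip
  | Assign of nat & expr
  | Seq of cmd & cmd
  | If of expr & cmd & cmd
  | While of expr & cmd.

Definition store : Type := nat -> tree.

Definition update (s : store) (x : nat) (t : tree) : store :=
  fun y => if y == x then t else s y.

Fixpoint eval (s : store) (e : expr) : tree :=
  match e with
  | EVar x => s x
  | ELeaf => Leaf
  | ENode e1 e2 => Node (eval s e1) (eval s e2)
  | EHead e1 => thead (eval s e1)
  | ETail e1 => ttail (eval s e1)
  end.

Fixpoint ecost (s : store) (e : expr) : nat :=
  tsize (eval s e) +
  match e with
  | EVar _ | ELeaf => 0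
  | ENode e1 e2 => ecost s e1 + ecost s e2
  | EHead e1 | ETail e1 => ecost s e1
  end.

(* [exec c s s' k]: started in store [s], [c] halts in store [s'] after time
   [k].  Trees are tested by [is_node]: [Leaf] is false. *)
Inductive exec : cmd -> store -> store -> nat -> Prop :=
  | ExecSkip s :
      exec Skip s s 1
  | ExecAssign s x e :
      exec (Assign x e) s (update s x (eval s e)) (ecost s e).+1
  | ExecSeq c1 c2 s s1 s2 k1 k2 :
      exec c1 s s1 k1 -> exec c2 s1 s2 k2 ->
      exec (Seq c1 c2) s s2 (k1 + k2).+1
  | ExecIfTrue e c1 c2 s s1 k :
      is_node (eval s e) -> exec c1 s s1 k ->
      exec (If e c1 c2) s s1 (ecost s e + k).+1
  | ExecIfFalse e c1 c2 s s1 k :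
      ~~ is_node (eval s e) -> exec c2 s s1 k ->
      exec (If e c1 c2) s s1 (ecost s e + k).+1
  | ExecWhileTrue e c s s1 s2 k1 k2 :
      is_node (eval s e) -> exec c s s1 k1 -> exec (While e c) s1 s2 k2 ->
      exec (While e c) s s2 (ecost s e + k1 + k2).+1
  | ExecWhileFalse e c s :
      ~~ is_node (eval s e) ->
      exec (While e c) s s (ecost s e).+1.

(* Input and output are in variable 0; all other variables start as [Leaf]. *)
Definition computes_in (c : cmd) (input output : tree) (k : nat) : Prop :=
  exists2 s : store, exec c (update (fun=> Leaf) 0 input) s k & s 0 = output.

Record problem : Type := Problem {
  instance : Type;
  admissible : instance -> Prop;
  encode : instance -> tree;
  correct_output : instance -> tree -> Prop }.

Definition restrict (P : problem) (Q : instance P -> Prop) : problem :=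
  {| instance := instance P;
     admissible := fun I => admissible I /\ Q I;
     encode := @encode P;
     correct_output := @correct_output P |}.

Definition polytime_solvable (P : problem) : Prop :=
  exists (c : cmd) (a d : nat), forall I : instance P, admissible I ->
    exists (output : tree) (k : nat),
      [/\ computes_in c (encode I) output k,
          k <= a * tsize (encode I) ^ d + a
        & correct_output I output].

(* Encodings.  Numbers are written in binary, least significant bit first,
   without trailing zeros. *)

Definition enc_seq (A : Type) (enc : A -> tree) (s : seq A) : tree :=
  foldr (fun x t => Node (enc x) t) Leaf s.

Definition enc_bit (b : bool) : tree := if b then Node Leaf Leaf else Leaf.

Fixpoint bits_of_pos (p : BinNums.positive) : seq bool :=
  match p with
  | BinNums.xH => [:: true]
  | BinNums.xO p' => false :: bits_of_pos p'
  | BinNums.xI p' => true :: bits_of_pos p'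
  end.

Definition bits_of_nat (n : nat) : seq bool :=
  if bin_of_nat n is BinNums.Npos p then bits_of_pos p else [::].

Definition enc_nat (n : nat) : tree := enc_seq enc_bit (bits_of_nat n).

(* Lengths are nonnegative, so that the sign is not recorded. *)
Definition enc_rat (q : rat) : tree :=
  Node (enc_nat `|numq q|%N) (enc_nat `|denq q|%N).

Definition enc_arc (n : nat) (e : 'I_n * 'I_n) : tree :=
  Node (enc_nat e.1) (enc_nat e.2).

Inductive graph_kind : Type := Undirected | Directed.

(* An undirected edge [u,v] is represented by the two pairs (u,v) and (v,u),
   with the same length and capacity (see [network_of_kind]).  Only the values
   of [len] and [cap] on [edges] are meaningful. *)
Record network : Type := Network {
  nverts : nat;
  edges : {set 'I_nverts * 'I_nverts};
  len : 'I_nverts * 'I_nverts -> rat;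
  cap : 'I_nverts * 'I_nverts -> nat;
  terminals : {set 'I_nverts};
  root : 'I_nverts }.

Definition arc_rel (n : nat) (A : {set 'I_n * 'I_n}) : rel 'I_n :=
  fun u v => (u, v) \in A.

Definition connected_graph (n : nat) (E : {set 'I_n * 'I_n}) : Prop :=
  forall u v : 'I_n, connect (fun x y => arc_rel E x y || arc_rel E y x) u v.

Definition network_of_kind (g : graph_kind) (N : network) : Prop :=
  match g with
  | Undirected => forall u v : 'I_(nverts N), (u, v) \in edges N ->
      [/\ (v, u) \in edges N, len (v, u) = len (u, v) & cap (v, u) = cap (u, v)]
  | Directed => forall v : 'I_(nverts N), connect (arc_rel (edges N)) (root N) v
  end.

Definition ml_admissible (g : graph_kind) (N : network) : Prop :=
  [/\ connected_graph (edges N),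
      network_of_kind g N,
      2 <= #|terminals N|,
      root N \notin terminals N
    & forall e, e \in edges N -> (0 <= len e)%R /\ 0 < cap e].

Definition ml_encode (N : network) : tree :=
  Node (enc_seq (fun v : 'I_(nverts N) => enc_nat v) (enum 'I_(nverts N)))
  (Node (enc_seq (fun e => Node (enc_arc e) (Node (enc_rat (len e))
                                                  (enc_nat (cap e))))
                 (enum (edges N)))
  (Node (enc_seq (fun v : 'I_(nverts N) => enc_nat v) (enum (terminals N)))
        (enc_nat (root N)))).

(* A tree directed away from [r] is given by its set [A] of arcs; [r] belongs
   to it even if [A] is empty. *)
Definition tree_vertices (n : nat) (r : 'I_n) (A : {set 'I_n * 'I_n}) :
    {set 'I_n} :=
  [set v | (v == r) || [exists u, ((u, v) \in A) || ((v, u) \in A)]].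

(* The walks are not required to be simple: their uniqueness also rules out
   cycles. *)
Definition out_tree (n : nat) (r : 'I_n) (A : {set 'I_n * 'I_n}) : Prop :=
  forall v : 'I_n, v \in tree_vertices r A ->
    exists! p : seq 'I_n, path (arc_rel A) r p /\ last r p = v.

Definition subtree (n : nat) (A : {set 'I_n * 'I_n}) (v : 'I_n) : {set 'I_n} :=
  [set w | connect (arc_rel A) v w].

Definition feasible (N : network) (A : {set 'I_(nverts N) * 'I_(nverts N)}) :
    Prop :=
  [/\ A \subset edges N,
      out_tree (root N) A,
      terminals N \subset tree_vertices (root N) A
    & forall u v, (u, v) \in A ->
        #|terminals N :&: subtree A v| <= cap (u, v)].

Definition total_length (N : network)
    (A : {set 'I_(nverts N) * 'I_(nverts N)}) : rat :=
  (\sum_(e in A) len e)%R.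

Definition optimal (N : network) (A : {set 'I_(nverts N) * 'I_(nverts N)}) :
    Prop :=
  feasible A /\
  forall B : {set 'I_(nverts N) * 'I_(nverts N)},
    feasible B -> (total_length A <= total_length B)%R.

(* The output is [Leaf] if there is no feasible tree; otherwise it is a [Node]
   whose left subtree lists the arcs of an optimal tree, in any order. *)
Definition ml_correct_output (N : network) (y : tree) : Prop :=
  (y = Leaf /\ forall A : {set 'I_(nverts N) * 'I_(nverts N)}, ~ feasible A)
  \/ (exists s : seq ('I_(nverts N) * 'I_(nverts N)),
        [/\ y = Node (enc_seq (@enc_arc _) s) Leaf, uniq s
          & optimal [set e in s]]).

Definition ML_CAP_STEINER_TREE (g : graph_kind) : problem :=
  {| instance := network;
     admissible := ml_admissible g;
     encode := ml_encode;
     correct_output := ml_correct_output |}.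

Definition unit_capacities (N : network) : Prop :=
  forall e, e \in edges N -> cap e = 1.

(* Main.v *)
From Pilot Require (* [Defs.tsize] again hides that of [tuple]. *)
Import Defs.
From HB Require Import structures.
From mathcomp Require Import all_boot all_order all_algebra.
From mathcomp Require Import zify.
Import Defs.

(* With unit capacities the branches of the tree at the root have at most one
   terminal each, so that a cheapest feasible tree consists of paths from the
   root r to the terminals that are disjoint outside r.  Closing these paths up
   at r turns them into the cycles of a permutation s of V \ {r}: a terminal t
   stands for the arc (r, s t), a nonterminal v for the arc (v, s v), or for no
   arc if s v = v.  So the problem is an assignment problem, with a prohibitive
   cost for missing arcs.  Lengths are scaled to natural numbers, multiplied by
   |V| + 1 and increased by 1: this does not affect which trees are shortest,
   but makes every arc cost something, so that an optimal permutation has no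
   nontrivial cycle avoiding the terminals.

   The assignment problem is solved by the Hungarian method.  Instead of
   storing an alternating tree, the search keeps for every reached row the
   whole permutation obtained by rerouting up to that row.

   Polynomial time is obtained from a calculus of polynomial-time functions
   between encoded types: it is closed under the usual programming constructs,
   and under folds whose accumulators stay of polynomial size.  Potentials at
   most double, up to a constant, in each search step, so that their bit sizes
   stay polynomial. *)

Set Implicit Arguments.
Unset Strict Implicit.
Unset Printing Implicit Defensive.

(** * Polynomial bounds *)

(** The correspondence with permutations need not be one-to-one. Closing up disjoint paths gives one
    terminal per cycle, but an optimal permutation may carry several terminals on one cycle; since
    the arc leaving a terminal starts at the root instead, such a cycle falls apart into one path
    per terminal, so all permutations may be allowed. In the other direction, arcs leading to no
    terminal are dropped, which does not lengthen a tree.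

    In the Hungarian method the assignment is a total permutation from the start, and tightness is
    required on the processed rows only; a column counts as free when an unprocessed row holds it.
    With a whole permutation kept for each reached row, a search step is a single exchange of
    columns, and no augmenting path has to be traced back.

    The obstacle to polynomial time is iteration: a polynomial bound per step, composed once for
    every step, need not be polynomial. Hence the explicit invariants on bit lengths, which grow
    additively. *)

Definition polybound (p : nat -> nat) : Prop :=
  {homo p : m n / m <= n} /\ exists a d, forall n, p n <= a * n.+1 ^ d.

Lemma polybound_id : polybound (fun n => n).
Proof. by split=> //; exists 1, 1 => n; rewrite mul1n expn1. Qed.

Lemma polybound_const c : polybound (fun=> c).
Proof. by split=> //; exists c, 0 => n; rewrite expn0 muln1. Qed.

Lemma polybound_add p q :
  polybound p -> polybound q -> polybound (fun n => p n + q n).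
Proof.
move=> [mp [a [d hp]]] [mq [a' [d' hq]]]; split=> [m n le_mn|].
  by rewrite leq_add ?mp ?mq.
exists (a + a'), (d + d') => n; rewrite mulnDl leq_add //.
  by apply: leq_trans (hp n) _; rewrite leq_mul2l leq_pexp2l ?leq_addr ?orbT.
by apply: leq_trans (hq n) _; rewrite leq_mul2l leq_pexp2l ?leq_addl ?orbT.
Qed.

Lemma polybound_mul p q :
  polybound p -> polybound q -> polybound (fun n => p n * q n).
Proof.
move=> [mp [a [d hp]]] [mq [a' [d' hq]]]; split=> [m n le_mn|].
  by rewrite leq_mul ?mp ?mq.
by exists (a * a'), (d + d') => n; rewrite expnD mulnACA leq_mul.
Qed.

Lemma polybound_comp p q :
  polybound p -> polybound q -> polybound (fun n => p (q n)).
Proof.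
move=> [mp [a [d hp]]] [mq [a' [d' hq]]]; split=> [m n le_mn|].
  by rewrite mp ?mq.
exists (a * a'.+1 ^ d), (d' * d) => n; apply: leq_trans (hp _) _.
rewrite -mulnA leq_mul2l; apply/orP; right.
rewrite expnM -expnMn; case: d {hp} => // d; rewrite leq_exp2r //.
by rewrite mulSn addnC -addn1 leq_add // expn_gt0.
Qed.

Ltac polyb := repeat first [assumption | exact: polybound_id
  | exact: polybound_const | apply: polybound_add | apply: polybound_mul
  | match goal with h : polybound ?p |- polybound (fun n => ?p _) =>
      apply: (polybound_comp h) end].

(** * Polynomial-time functions between encoded types *)

Lemma tsize_gt0 t : 0 < tsize t. Proof. by case: t. Qed.

(** Every evaluated expression is charged its size, so a value present at the end was either there
    at the start or has been paid for. *)
Lemma exec_size c s s' k y :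
  exec c s s' k -> tsize (s' y) <= maxn (tsize (s y)) k.
Proof.
elim=> {c s s' k} [s|s x e|c1 c2 s s1 s2 k1 k2 _ h1 _ h2
  |e c1 c2 s s1 k _ _ h|e c1 c2 s s1 k _ _ h
  |e c s s1 s2 k1 k2 _ _ h1 _ h2|e c s _]; try lia.
rewrite /update; case: eqP => _; last by lia.
by case: e => *; rewrite /=; lia.
Qed.

Class Enc (A : Type) := enc : A -> tree.
Arguments enc : simpl never.
Instance enc_tree_inst : Enc tree := id.
Instance enc_bool_inst : Enc bool := enc_bit.
Instance enc_nat_inst : Enc nat := enc_nat.
Instance enc_seq_inst (A : Type) (eA : Enc A) : Enc (seq A) := enc_seq enc.
Instance enc_pair_inst (A B : Type) (eA : Enc A) (eB : Enc B) : Enc (A * B) :=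
  fun x => Node (enc x.1) (enc x.2).
(** Agrees with the output format of the problem: [Leaf] for infeasibility, otherwise the list of
    arcs in a [Node] with right subtree [Leaf]. *)
Instance enc_option_inst (A : Type) (eA : Enc A) : Enc (option A) :=
  fun x => if x is Some y then Node (enc y) Leaf else Leaf.

Arguments enc_tree_inst : simpl never.
Arguments enc_bool_inst : simpl never.
Arguments enc_nat_inst : simpl never.
Arguments enc_seq_inst A eA : simpl never.
Arguments enc_pair_inst A B eA eB : simpl never.
Arguments enc_option_inst A eA : simpl never.

Notation esize x := (tsize (enc x)).

(* The command keeps its argument and its result in variable [b], leaves the
   variables below [b] alone and assumes nothing on those above, so that
   commands with a larger base can serve as subroutines. *)
Definition polytime (A B : Type) {eA : Enc A} {eB : Enc B} (f : A -> B) : Prop :=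
  forall b : nat, exists c p, polybound p /\
    forall (s : store) (x : A), s b = enc x -> exists s' k,
      [/\ exec c s s' k, s' b = enc (f x), (forall y, y < b -> s' y = s y)
        & k <= p (esize x)].

(** By [exec_size], a result cannot outgrow the argument and the running time together. This
    supplies the size bounds on which compositions and loops depend. *)
Lemma pt_size {A B : Type} {eA : Enc A} {eB : Enc B} (f : A -> B) :
  polytime f -> exists2 p, polybound p & forall x, esize (f x) <= p (esize x).
Proof.
move=> /(_ 0) [c [p [hp h]]]; exists (fun n => n + p n); [by polyb|move=> x].
have [s' [k [/(exec_size 0) + s'0 _ le_k]]] := h (fun=> enc x) x erefl.
by rewrite s'0; lia.
Qed.

Section Closure.
Context {A B C : Type} {eA : Enc A} {eB : Enc B} {eC : Enc C}.

Lemma pt_ext (f g : A -> B) : f =1 g -> polytime f -> polytime g.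
Proof.
move=> fg h b; have [c [p [hp hc]]] := h b; exists c, p; split=> // s x sx.
by have [s' [k [? ? ? ?]]] := hc s x sx; exists s', k; rewrite -fg.
Qed.

(** Only encodings matter to a command: consing, for instance, costs the same as pairing, since both
    build a [Node]. *)
Lemma pt_coerce (f : A -> B) (g : A -> C) :
  (forall x, enc (g x) = enc (f x)) -> polytime f -> polytime g.
Proof.
move=> fg h b; have [c [p [hp hc]]] := h b; exists c, p; split=> // s x sx.
by have [s' [k [? ? ? ?]]] := hc s x sx; exists s', k; rewrite fg.
Qed.

Lemma pt_id : polytime (fun x : A => x).
Proof.
move=> b; exists Skip, (fun=> 1); split; [by polyb|move=> s x sx].
by exists s, 1; split=> //; constructor.
Qed.

Lemma pt_comp (g : B -> C) (f : A -> B) :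
  polytime f -> polytime g -> polytime (fun x => g (f x)).
Proof.
move=> hf hg b; have [q hq le_q] := pt_size hf.
have [cf [pf [hpf hcf]]] := hf b; have [cg [pg [hpg hcg]]] := hg b.
exists (Seq cf cg), (fun n => pf n + pg (q n) + 1); split.
  by polyb.
move=> s x sx; have [s1 [k1 [e1 sx1 u1 l1]]] := hcf s x sx.
have [s2 [k2 [e2 sx2 u2 l2]]] := hcg s1 (f x) sx1.
exists s2, (k1 + k2).+1; split=> //; first exact: ExecSeq e1 e2.
  by move=> y ltyb; rewrite u2 ?u1.
(* Of the size of [f x] only an upper bound is known; this is why a [polybound] is monotone by
   definition. *)
have := leq_trans l2 (hpg.1 _ _ (le_q x)); lia.
Qed.

Lemma pt_const (c : B) : polytime (fun _ : A => c).
Proof.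
have [e [m he]] : exists e m, forall s, eval s e = enc c /\ ecost s e = m.
  elim: (enc c) => [|t1 [e1 [m1 h1]] t2 [e2 [m2 h2]]]; first by exists ELeaf, 1.
  exists (ENode e1 e2), ((tsize t1 + tsize t2).+1 + (m1 + m2)) => s /=.
  by have [-> ->] := h1 s; have [-> ->] := h2 s.
move=> b; exists (Assign b e), (fun=> m.+1); split; [by polyb|move=> s x _].
exists (update s b (eval s e)), (ecost s e).+1; split.
- exact: ExecAssign.
- by rewrite /update eqxx (he s).1.
- by move=> y ltyb; rewrite /update ltn_eqF.
- by rewrite (he s).2.
Qed.

Lemma pt_pair (f : A -> B) (g : A -> C) :
  polytime f -> polytime g -> polytime (fun x => (f x, g x)).
Proof.
move=> hf hg b; have [qf hqf le_qf] := pt_size hf.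
have [qg hqg le_qg] := pt_size hg.
have [cf [pf [hpf hcf]]] := hf b.+1; have [cg [pg [hpg hcg]]] := hg b.+2.
exists (Seq (Assign b.+1 (EVar b)) (Seq cf (Seq (Assign b.+2 (EVar b))
         (Seq cg (Assign b (ENode (EVar b.+1) (EVar b.+2))))))),
  (fun n => n + n + pf n + pg n + qf n + qg n + qf n + qg n + 10).
split; first by polyb.
move=> s x sx; pose s0 := update s b.+1 (s b).
have [|s1 [k1 [e1 sx1 u1 l1]]] := hcf s0 x; first by rewrite /s0 /update eqxx.
pose s2 := update s1 b.+2 (s1 b).
have s1b : s1 b = enc x by rewrite u1 // /s0 /update ltn_eqF.
have [|s3 [k3 [e3 sx3 u3 l3]]] := hcg s2 x; first by rewrite /s2 /update eqxx.
pose e := ENode (EVar b.+1) (EVar b.+2).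
have s3b : s3 b.+1 = enc (f x) by rewrite u3 // /s2 /update ltn_eqF.
exists (update s3 b (eval s3 e)); eexists; split.
- apply: ExecSeq; first exact: ExecAssign.
  apply: ExecSeq; first exact: e1.
  apply: ExecSeq; first exact: ExecAssign.
  by apply: ExecSeq; [exact: e3 | exact: ExecAssign].
- by rewrite /update eqxx /= s3b sx3.
- move=> y ltyb; rewrite /update ltn_eqF // u3; last lia.
  rewrite /s2 /update ltn_eqF; last lia.
  by rewrite u1 /s0 /update ?ltn_eqF //; lia.
- rewrite /= sx s1b s3b sx3.
  by have := le_qf x; have := le_qg x; lia.
Qed.

End Closure.

Lemma pt_comp2 {A B C D : Type} {eA : Enc A} {eB : Enc B} {eC : Enc C}
    {eD : Enc D} (h : B -> C -> D) (f : A -> B) (g : A -> C) :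
  polytime (fun z : B * C => h z.1 z.2) -> polytime f -> polytime g ->
    polytime (fun x => h (f x) (g x)).
Proof. by move=> hh hf hg; apply: pt_comp (pt_pair hf hg) hh. Qed.

Lemma pt_lift {A B : Type} {eA : Enc A} {eB : Enc B} (F : tree -> tree)
    (f : A -> B) :
  (forall x, enc (f x) = F (enc x)) -> polytime F -> polytime f.
Proof.
move=> fF h b; have [c [p [hp hc]]] := h b; exists c, p; split=> // s x sx.
by have [s' [k [? ? ? ?]]] := hc s (enc x) sx; exists s', k; rewrite fF.
Qed.

Lemma pt_thead : polytime thead.
Proof.
move=> b; exists (Assign b (EHead (EVar b))), (fun n => n + n + 1).
split; first by polyb.
move=> s t sx; do 2!eexists; split; first exact: ExecAssign.
- by rewrite /update eqxx /= sx.
- by move=> y ltyb; rewrite /update ltn_eqF.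
- by rewrite /= sx /enc; case: {sx} t => //= *; rewrite -?[enc _]/(_); lia.
Qed.

Lemma pt_ttail : polytime ttail.
Proof.
move=> b; exists (Assign b (ETail (EVar b))), (fun n => n + n + 1).
split; first by polyb.
move=> s t sx; do 2!eexists; split; first exact: ExecAssign.
- by rewrite /update eqxx /= sx.
- by move=> y ltyb; rewrite /update ltn_eqF.
- by rewrite /= sx /enc; case: {sx} t => //= *; lia.
Qed.

Section Control.
Context {A B C : Type} {eA : Enc A} {eB : Enc B} {eC : Enc C}.

Lemma pt_fst (f : A -> B * C) : polytime f -> polytime (fun x => (f x).1).
Proof. by move=> hf; apply: pt_comp hf _; apply: pt_lift pt_thead. Qed.

Lemma pt_snd (f : A -> B * C) : polytime f -> polytime (fun x => (f x).2).
Proof. by move=> hf; apply: pt_comp hf _; apply: pt_lift pt_ttail. Qed.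

Lemma is_node_bit (c : bool) : is_node (enc c) = c.
Proof. by case: c. Qed.

Lemma pt_if (c : A -> bool) (f g : A -> B) :
  polytime c -> polytime f -> polytime g ->
    polytime (fun x => if c x then f x else g x).
Proof.
move=> hc hf hg b.
have [cc [pc [hpc hcc]]] := hc b.+1.
have [cf [pf [hpf hcf]]] := hf b; have [cg [pg [hpg hcg]]] := hg b.
exists (Seq (Assign b.+1 (EVar b)) (Seq cc (If (EVar b.+1) cf cg))),
  (fun n => n + pc n + pf n + pg n + 10).
split; first by polyb.
move=> s x sx; pose s0 := update s b.+1 (s b).
have [|s1 [k1 [e1 sx1 u1 l1]]] := hcc s0 x; first by rewrite /s0 /update eqxx.
have s1b : s1 b = enc x by rewrite u1 // /s0 /update ltn_eqF.
have s1y y : y < b -> s1 y = s y.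
  by move=> ltyb; rewrite u1 /s0 /update ?ltn_eqF //; lia.
have sizec : tsize (enc (c x)) <= 3 by case: (c x).
case Dc: (c x).
- have [s2 [k2 [e2 sx2 u2 l2]]] := hcf s1 x s1b.
  exists s2; eexists; split.
  + apply: ExecSeq; first exact: ExecAssign.
    apply: ExecSeq; first exact: e1.
    by apply: ExecIfTrue e2; rewrite /= sx1 is_node_bit.
  + by [].
  + by move=> y ltyb; rewrite u2 ?s1y.
  + by rewrite /= sx sx1; lia.
- have [s2 [k2 [e2 sx2 u2 l2]]] := hcg s1 x s1b.
  exists s2; eexists; split.
  + apply: ExecSeq; first exact: ExecAssign.
    apply: ExecSeq; first exact: e1.
    by apply: ExecIfFalse e2; rewrite /= sx1 is_node_bit Dc.
  + by [].
  + by move=> y ltyb; rewrite u2 ?s1y.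
  + by rewrite /= sx sx1; lia.
Qed.

End Control.

Section Foldl.
Context {A B C : Type} {eA : Enc A} {eB : Enc B} {eC : Enc C}.
Variables (step : A -> B -> C -> B) (init : A -> B) (l : A -> seq C).

Lemma size_enc_seq (s : seq C) : size s < esize s.
Proof. by elim: s => //= a s; rewrite /enc /=; case: (enc a) => /=; lia. Qed.

(** A polynomial-time step might double its accumulator each time, so its own size bound says
    nothing about a loop. The uniform bound [q] on the accumulators after all prefixes excludes
    this, and each round then costs a fixed polynomial. *)
Lemma pt_foldl q : polybound q ->
  (forall x i, esize (foldl (step x) (init x) (take i (l x))) <= q (esize x)) ->
  polytime (fun z : A * B * C => step z.1.1 z.1.2 z.2) -> polytime init ->
    polytime l ->
  polytime (fun x => foldl (step x) (init x) (l x)).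
Proof.
move=> hq le_q hstep hinit hl b.
have [ql hql le_ql] := pt_size hl.
have [cl [pl [hpl hcl]]] := hl b.+1; have [ci [pi [hpi hci]]] := hinit b.+2.
have [cs [ps [hps hcs]]] := hstep b.+3.
(* Variable [b] keeps the argument, [b.+1] the rest of the list and [b.+2] the accumulator; [b.+3]
   is the base for the step. *)
pose ez := ENode (ENode (EVar b) (EVar b.+2)) (EHead (EVar b.+1)).
pose body := Seq (Assign b.+3 ez) (Seq cs (Seq (Assign b.+2 (EVar b.+3))
               (Assign b.+1 (ETail (EVar b.+1))))).
pose loop := While (EVar b.+1) body.
pose sz n := n + q n + ql n + 2.
pose cost n := 10 * sz n + ps (sz n) + 20.
have hsz : polybound sz by polyb.
have hcost : polybound cost by polyb.
have loopP x s r acc : s b = enc x -> s b.+1 = enc r -> s b.+2 = enc acc ->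
    (forall i, esize (foldl (step x) acc (take i r)) <= q (esize x)) ->
    esize r <= ql (esize x) ->
  exists s' k, [/\ exec loop s s' k, s' b.+2 = enc (foldl (step x) acc r),
     (forall y, y <= b -> s' y = s y) & k <= (size r).+1 * cost (esize x)].
  elim: r acc s => [|a r IHr] acc s sb sb1 sb2 hacc hr.
    exists s; eexists; split.
    - by apply: (@ExecWhileFalse (EVar b.+1) body); rewrite /= sb1.
    - by [].
    - by [].
    - by rewrite /= sb1 /= mul1n /cost; lia.
  have szr : esize (a :: r) = (esize a + esize r).+1 by [].
  have /= acc0 := hacc 0.
  pose z := (x, acc, a); pose s1 := update s b.+3 (eval s ez).
  have szz : esize z = ((esize x + esize acc).+1 + esize a).+1 by [].
  have evz : eval s ez = enc z by rewrite /= sb sb1 sb2.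
  have s1z : s1 b.+3 = enc z by rewrite /s1 /update eqxx evz.
  have [s2 [k2 [e2 sx2 u2 l2]]] := hcs s1 z s1z.
  pose s3 := update s2 b.+2 (s2 b.+3).
  pose s4 := update s3 b.+1 (eval s3 (ETail (EVar b.+1))).
  have s2y y : y < b.+3 -> s2 y = s y.
    by move=> lty; rewrite u2 // /s1 /update ltn_eqF.
  have s3b1 : s3 b.+1 = enc (a :: r).
    by rewrite /s3 /update ltn_eqF // s2y.
  have s4y y : y <= b -> s4 y = s y.
    move=> ley; rewrite /s4 /s3 /update !ltn_eqF ?s2y ?ltnS //; lia.
  have [|||||s' [k' [e' sx' u' l']]] := IHr (step x acc a) s4.
  - by rewrite s4y.
  - by rewrite /s4 /update eqxx [eval _ _]/= s3b1.
  - by rewrite /s4 /s3 /update gtn_eqF // eqxx sx2.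
  - by move=> i; apply: (hacc i.+1).
  - by lia.
  have le_k2 : k2 <= ps (sz (esize x)).
    by apply: leq_trans l2 (hps.1 _ _ _); rewrite szz /sz; lia.
  have acc1 : esize (step x acc a) <= q (esize x).
    by have := hacc 1; rewrite /= take0.
  exists s'; eexists; split.
  - apply: (@ExecWhileTrue (EVar b.+1) body) e'; first by rewrite /= sb1.
    apply: ExecSeq; first exact: ExecAssign.
    apply: ExecSeq; first exact: e2.
    by apply: ExecSeq; exact: ExecAssign.
  - by [].
  - by move=> y ley; rewrite u' ?s4y.
  - have cost_ez : ecost s ez = esize z + ((esize x + esize acc).+1 +
        (esize x + 0 + (esize acc + 0)) + (esize a + (esize (a :: r) + 0))).
      by rewrite /= sb sb1 sb2.
    have cost_b1 : ecost s (EVar b.+1) = esize (a :: r) by rewrite /= sb1 addn0.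
    have cost_b3 : ecost s2 (EVar b.+3) = esize (step x acc a).
      by rewrite /= sx2 addn0.
    have cost_tl : ecost s3 (ETail (EVar b.+1)) = esize r + esize (a :: r).
      by rewrite /= s3b1 addn0.
    rewrite cost_ez cost_b1 cost_b3 cost_tl mulSn szz.
    by rewrite {1}/cost; move: l' le_k2; rewrite /sz; lia.
exists (Seq (Assign b.+1 (EVar b)) (Seq cl (Seq (Assign b.+2 (EVar b))
        (Seq ci (Seq loop (Assign b (EVar b.+2))))))),
   (fun n => n + n + pl n + pi n + (ql n).+1 * cost n + q n + 10).
split.
  by rewrite /cost /sz; polyb.
move=> s x sx; pose s1 := update s b.+1 (s b).
have [|s2 [k2 [e2 sx2 u2 l2]]] := hcl s1 x; first by rewrite /s1 /update eqxx.
pose s3 := update s2 b.+2 (s2 b).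
have s2b : s2 b = enc x by rewrite u2 // /s1 /update ltn_eqF.
have [|s4 [k4 [e4 sx4 u4 l4]]] := hci s3 x; first by rewrite /s3 /update eqxx.
have s4b : s4 b = enc x by rewrite u4 /s3 /update ?ltn_eqF //; lia.
have s4b1 : s4 b.+1 = enc (l x) by rewrite u4 // /s3 /update ltn_eqF.
have [s5 [k5 [e5 sx5 u5 l5]]] :=
  loopP x s4 (l x) (init x) s4b s4b1 sx4 (le_q x) (le_ql x).
exists (update s5 b (s5 b.+2)); eexists; split.
- apply: ExecSeq; first exact: ExecAssign.
  apply: ExecSeq; first exact: e2.
  apply: ExecSeq; first exact: ExecAssign.
  apply: ExecSeq; first exact: e4.
  by apply: ExecSeq; [exact: e5 | exact: ExecAssign].
- by rewrite /update eqxx.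
- move=> y lty; rewrite /update ltn_eqF // u5; last lia.
  rewrite u4 /s3 /update ?ltn_eqF; try lia.
  by rewrite u2 /s1 /update ?ltn_eqF //; lia.
- have := le_q x (size (l x)); rewrite take_size => le_acc.
  have lt_l : (size (l x)).+1 <= (ql (esize x)).+1.
    by have := size_enc_seq (l x); have := le_ql x; lia.
  have : (size (l x)).+1 * cost (esize x) <= (ql (esize x)).+1 * cost (esize x).
    by rewrite leq_mul2r lt_l orbT.
  by rewrite /= sx s2b sx5; move: l5; move: (cost _) => C0; lia.
Qed.
End Foldl.
Arguments tsize : simpl never.

(** * Functions on lists *)

Lemma esize_gt0 {A : Type} {eA : Enc A} (x : A) : 0 < esize x.
Proof. exact: tsize_gt0. Qed.

Lemma pt_comp3 {A B C D E : Type} {eA : Enc A} {eB : Enc B} {eC : Enc C}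
    {eD : Enc D} {eE : Enc E} (h : B -> C -> D -> E)
    (f : A -> B) (g : A -> C) (k : A -> D) :
  polytime (fun z : B * C * D => h z.1.1 z.1.2 z.2) -> polytime f ->
    polytime g -> polytime k ->
  polytime (fun x => h (f x) (g x) (k x)).
Proof. by move=> hh hf hg hk; apply: pt_comp (pt_pair (pt_pair hf hg) hk) hh. Qed.

(** A hook, extended as closure properties become available; [pt] then proves [polytime] by
    recursion on the syntax of the function. *)
Ltac pt_lemma := fail.
Ltac pt_step :=
  match goal with
  | h : polytime ?f |- polytime ?f => exact h
  | |- polytime (fun x => x) => exact pt_id
  | |- polytime fst => refine (pt_fst pt_id)
  | |- polytime snd => refine (pt_snd pt_id)
  | |- polytime (fun _ => ?c) => exact (pt_const c)
  | |- polytime (fun x => pair (@?f x) (@?g x)) =>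
      refine (pt_pair (f := f) (g := g) _ _)
  | |- polytime (fun x => fst (@?f x)) => refine (pt_fst (f := f) _)
  | |- polytime (fun x => snd (@?f x)) => refine (pt_snd (f := f) _)
  | h : polytime ?f |- polytime (fun x => ?f x) => exact h
  | h : polytime ?f |- polytime (fun x => ?f (@?a x)) =>
      refine (pt_comp (_ : polytime a) h)
  | h : polytime (fun z => ?F (fst z) (snd z))
      |- polytime (fun x => ?F (@?a x) (@?b x)) =>
      refine (pt_comp2 (h := F) h (_ : polytime a) (_ : polytime b))
  | h : polytime (fun z => ?F (fst (fst z)) (snd (fst z)) (snd z))
      |- polytime (fun x => ?F (@?a x) (@?b x) (@?c x)) =>
      refine (pt_comp3 (h := F) h (_ : polytime a) (_ : polytime b) (_ : polytime c))
  | _ => pt_lemma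
  | |- polytime (fun x => if _ then _ else _) => simple apply pt_if
  end.
Ltac pt := repeat (cbv beta; pt_step).

Section ListSizes.
Context {A : Type} {eA : Enc A}.

Lemma esize_cons (a : A) s : esize (a :: s) = (esize a + esize s).+1.
Proof. by []. Qed.

Lemma esize_nil : esize (@nil A) = 1.
Proof. by []. Qed.

Lemma esize_cat (s t : seq A) : (esize (s ++ t)).+1 = esize s + esize t.
Proof. by elim: s => //= a s IHs; rewrite !esize_cons addSn -addnA -IHs addnS. Qed.

Lemma esize_take i (s : seq A) : esize (take i s) <= esize s.
Proof.
have := esize_cat (take i s) (drop i s); rewrite cat_take_drop.
have : 0 < esize (drop i s) by exact: esize_gt0.
by lia.
Qed.

Lemma esize_drop i (s : seq A) : esize (drop i s) <= esize s.
Proof.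
have := esize_cat (take i s) (drop i s); rewrite cat_take_drop.
have : 0 < esize (take i s) by exact: esize_gt0.
by lia.
Qed.

Lemma esize_rev (s : seq A) : esize (rev s) = esize s.
Proof.
elim: s => //= a s IHs; rewrite rev_cons -cats1 esize_cons.
by have := esize_cat (rev s) [:: a]; rewrite esize_cons esize_nil IHs; lia.
Qed.

Lemma esize_nth a0 i (s : seq A) : i < size s -> esize (nth a0 s i) <= esize s.
Proof.
elim: s i => // a s IHs [|i] lt_i; rewrite esize_cons; first by rewrite /=; lia.
exact: leq_trans (IHs i lt_i) (leqW (leq_addl _ _)).
Qed.

End ListSizes.
Section Lists.
Context {A B C : Type} {eA : Enc A} {eB : Enc B} {eC : Enc C}.

Lemma pt_cons (f : A -> B) (g : A -> seq B) :
  polytime f -> polytime g -> polytime (fun x => f x :: g x).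
Proof. by move=> hf hg; apply: pt_coerce (pt_pair hf hg) => x. Qed.

Lemma pt_some (f : A -> B) : polytime f -> polytime (fun x => Some (f x)).
Proof.
by move=> hf; apply: pt_coerce (pt_pair hf (pt_const ([::] : seq B))) => x.
Qed.

(** The invariant counts the rounds, so that accumulators may grow with the progress made and yet be
    bounded at the end. *)
Lemma pt_foldl_inv (step : A -> B -> C -> B) (init : A -> B) (l : A -> seq C)
    (I : A -> nat -> B -> Prop) q :
  polybound q ->
  (forall x, I x 0 (init x)) ->
  (forall x i acc a, i < size (l x) -> esize a <= esize (l x) ->
     I x i acc -> I x i.+1 (step x acc a)) ->
  (forall x i acc, i <= size (l x) -> I x i acc -> esize acc <= q (esize x)) ->
  polytime (fun z : A * B * C => step z.1.1 z.1.2 z.2) -> polytime init ->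
    polytime l ->
  polytime (fun x => foldl (step x) (init x) (l x)).
Proof.
move=> hq I0 IS Iq hs hi hl; apply: pt_foldl hq _ hs hi hl => x i.
wlog le_i : i / i <= size (l x) => [hwlog|].
  have [/hwlog//|/ltnW le_i] := leqP i (size (l x)).
  by rewrite take_oversize // -(take_size (l x)) hwlog.
apply: (Iq x i) => //; elim: i le_i => [|i IHi] lt_i; first by rewrite take0.
case: (l x) lt_i IHi (IS x i) => // a0 s lt_i IHi {}IS.
rewrite (take_nth a0) // foldl_rcons; apply: IS => //; last exact: IHi (ltnW _).
exact: esize_nth.
Qed.

End Lists.

Section Combinators.
Context {A B C : Type} {eA : Enc A} {eB : Enc B} {eC : Enc C}.
Implicit Type l : A -> seq B.

Lemma pt_andb (f g : A -> bool) : polytime f -> polytime g ->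
  polytime (fun x => f x && g x).
Proof. by move=> hf hg; exact (pt_if hf hg (pt_const false)). Qed.

Lemma pt_orb (f g : A -> bool) : polytime f -> polytime g ->
  polytime (fun x => f x || g x).
Proof. by move=> hf hg; exact (pt_if hf (pt_const true) hg). Qed.

Lemma pt_negb (f : A -> bool) : polytime f -> polytime (fun x => ~~ f x).
Proof. by move=> hf; exact (pt_if hf (pt_const false) (pt_const true)). Qed.

Lemma pt_addb (f g : A -> bool) : polytime f -> polytime g ->
  polytime (fun x => f x (+) g x).
Proof.
move=> hf hg; apply: pt_ext (pt_if hf (pt_negb hg) hg) => x.
by case: (f x) (g x) => [] [].
Qed.

Lemma esize_bool (b : bool) : esize b <= 3.
Proof. by case: b. Qed.

End Combinators.

Ltac pt_lemma ::= first [simple apply pt_cons | simple apply pt_andb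
  | simple apply pt_orb | simple apply pt_negb | simple apply pt_addb
  | simple apply pt_some].

Lemma pt_rev {A B : Type} {eA : Enc A} {eB : Enc B} (l : A -> seq B) :
  polytime l -> polytime (fun x => rev (l x)).
Proof.
move=> hl; apply: (pt_ext (f := fun x => foldl (fun r a => a :: r) [::] (l x))).
  by move=> x; rewrite -{1}[l x]revK foldl_rev; elim: (rev (l x)) => //= a r ->.
have foldlE (s : seq B) : foldl (fun r a => a :: r) [::] s = rev s.
  by rewrite -{1}[s]revK foldl_rev; elim: (rev s) => //= a r ->.
have [q hq le_q] := pt_size hl.
apply: pt_foldl hq _ _ _ hl => [x i||].
- by rewrite foldlE esize_rev; apply: leq_trans (esize_take _ _) (le_q x).
- by pt.
- exact: pt_const.
Qed.

Lemma pt_foldr {A B C : Type} {eA : Enc A} {eB : Enc B} {eC : Enc C}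
    (step : A -> C -> B -> B) (init : A -> B) (l : A -> seq C) q :
  polybound q ->
  (forall x i, esize (foldr (step x) (init x) (drop i (l x))) <= q (esize x)) ->
  polytime (fun z : A * C * B => step z.1.1 z.1.2 z.2) -> polytime init ->
    polytime l ->
  polytime (fun x => foldr (step x) (init x) (l x)).
Proof.
move=> hq le_q hs hi hl.
apply: (pt_ext (f := fun x =>
          foldl (fun acc a => step x a acc) (init x) (rev (l x)))).
  by move=> x; rewrite foldl_rev.
apply: pt_foldl hq _ _ hi (pt_rev hl) => [x i|].
  by rewrite take_rev foldl_rev.
apply: (pt_comp (A := A * B * C) (f := fun z => (z.1.1, z.2, z.1.2)) _ hs).
by pt.
Qed.

Section Combinators1.
Context {A B C : Type} {eA : Enc A} {eB : Enc B} {eC : Enc C}.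
Implicit Type l : A -> seq B.

(** The hypothesis selects elements by size rather than by membership, since [B] need not have
    decidable equality. *)
Lemma esize_map_leq (f : B -> C) (r : seq B) m :
  (forall b, esize b <= esize r -> esize (f b) <= m) ->
  esize (map f r) <= esize r * m.+1.
Proof.
have [n] := ubnP (esize r); move: {-2}n (leqnn n) => k.
elim: r k => [|b r IHr] k le_kn lt_rk hm.
  by rewrite esize_nil mul1n.
rewrite /= !esize_cons.
have hb : esize (f b) <= m by apply: hm; rewrite esize_cons; lia.
have hr : esize (map f r) <= esize r * m.+1.
  apply: (IHr k) => //; first by move: lt_rk; rewrite esize_cons; lia.
  by move=> b' le_b'; apply: hm; rewrite esize_cons; lia.
have : 0 < esize b by exact: esize_gt0.
by nia.
Qed.

Lemma pt_map (f : A -> B -> C) l :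
  polytime (fun z : A * B => f z.1 z.2) -> polytime l ->
    polytime (fun x => map (f x) (l x)).
Proof.
move=> hf hl; have [p hp le_p] := pt_size hf; have [q hq le_q] := pt_size hl.
apply: (pt_foldr (q := fun n => q n * (p (n + q n + 1) + 1))
  (step := fun x a r => f x a :: r) (init := fun=> [::])).
- by polyb.
- move=> x i; rewrite -/(map _ _).
  have le_d := leq_trans (esize_drop i (l x)) (le_q x).
  apply: leq_trans (esize_map_leq (m := p (esize x + q (esize x) + 1)) _) _.
    move=> b le_b; apply: leq_trans (le_p (x, b)) (hp.1 _ _ _).
    by change (esize (x, b)) with (esize x + esize b).+1; lia.
  by apply: leq_mul => //; lia.
- by pt.
- by pt.
- by pt.
Qed.

End Combinators1.

Section Combinators2.
Context {A B C : Type} {eA : Enc A} {eB : Enc B} {eC : Enc C}.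
Implicit Type l : A -> seq B.

Lemma esize_filter (P : pred B) r : esize (filter P r) <= esize r.
Proof.
elim: r => //= b r IHr; case: (P b); rewrite !esize_cons; lia.
Qed.

Lemma pt_filter (P : A -> B -> bool) l :
  polytime (fun z : A * B => P z.1 z.2) -> polytime l ->
  polytime (fun x => filter (P x) (l x)).
Proof.
move=> hP hl; have [q hq le_q] := pt_size hl.
apply: (pt_foldr (q := q) (init := fun=> [::])
  (step := fun x a r => if P x a then a :: r else r)) => //.
- move=> x i; rewrite -/(filter _ _).
  apply: leq_trans (esize_filter _ _) _.
  exact: leq_trans (esize_drop i (l x)) (le_q x).
- by pt.
- by pt.
Qed.

Lemma pt_all (P : A -> B -> bool) l :
  polytime (fun z : A * B => P z.1 z.2) -> polytime l ->
    polytime (fun x => all (P x) (l x)).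
Proof.
move=> hP hl; apply: (pt_foldr (q := fun=> 3) (init := fun=> true)
  (step := fun x a r => P x a && r)) => //.
- by polyb.
- by move=> x i; apply: esize_bool.
- by pt.
- by pt.
Qed.

Lemma pt_has (P : A -> B -> bool) l :
  polytime (fun z : A * B => P z.1 z.2) -> polytime l ->
    polytime (fun x => has (P x) (l x)).
Proof.
move=> hP hl; apply: (pt_foldr (q := fun=> 3) (init := fun=> false)
  (step := fun x a r => P x a || r)) => //.
- by polyb.
- by move=> x i; apply: esize_bool.
- by pt.
- by pt.
Qed.

Definition first_sat (P : pred B) (r : seq B) (b0 : B) : B :=
  foldr (fun b acc => if P b then b else acc) b0 r.

Lemma pt_first_sat (P : A -> B -> bool) l (d : A -> B) :
  polytime (fun z : A * B => P z.1 z.2) -> polytime l -> polytime d ->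
  polytime (fun x => first_sat (P x) (l x) (d x)).
Proof.
move=> hP hl hd; have [q hq le_q] := pt_size hl; have [p hp le_p] := pt_size hd.
apply: (pt_foldr (q := fun n => q n + p n)
  (step := fun x a r => if P x a then a else r)) => //.
- by polyb.
- move=> x i; apply: leq_trans (leq_add (le_q x) (le_p x)).
  apply: leq_trans (leq_add (esize_drop i (l x)) (leqnn _)).
  elim: (drop i (l x)) => [|b r IHr] /=; first exact: leq_addl.
  by rewrite esize_cons; case: (P x b); lia.
- by pt.
Qed.

Lemma pt_cat l1 l2 : polytime l1 -> polytime l2 -> polytime (fun x => l1 x ++ l2 x).
Proof.
move=> h1 h2; have [q hq le_q] := pt_size h1; have [p hp le_p] := pt_size h2.
apply: (pt_ext (f := fun x => foldr cons (l2 x) (l1 x))).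
  by move=> x; elim: (l1 x) => //= a r ->.
apply: (pt_foldr (q := fun n => q n + p n) (step := fun=> cons)) => //.
- by polyb.
- move=> x i; have -> r : foldr cons (l2 x) r = r ++ l2 x.
    by elim: r => //= a r ->.
  apply: leq_trans (leq_add (le_q x) (le_p x)).
  apply: leq_trans (leq_add (esize_drop i (l1 x)) (leqnn _)).
  by rewrite -esize_cat.
- by pt.
Qed.

End Combinators2.

Lemma pt_flatten {A B : Type} {eA : Enc A} {eB : Enc B}
    (f : A -> seq (seq B)) :
  polytime f -> polytime (fun x => flatten (f x)).
Proof.
move=> hf; have [q hq le_q] := pt_size hf.
apply: (pt_foldr (q := q) (step := fun=> cat) (init := fun=> [::])) => //.
- move=> x i; rewrite -/(flatten _).
  apply: leq_trans _ (leq_trans (esize_drop i (f x)) (le_q x)).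
  elim: (drop i (f x)) => [|s r IHr] //=; rewrite esize_cons.
  by rewrite -ltnS esize_cat; lia.
- exact: pt_cat (pt_snd (pt_fst pt_id)) (pt_snd pt_id).
- by pt.
Qed.

Ltac pt_lemma ::= first [simple apply pt_cons | simple apply pt_andb
  | simple apply pt_orb | simple apply pt_negb | simple apply pt_addb
  | simple apply pt_some | simple apply pt_rev | simple apply pt_cat
  | simple apply pt_flatten | simple apply pt_map | simple apply pt_filter
  | simple apply pt_all | simple apply pt_has | simple apply pt_first_sat].

(** * Binary arithmetic *)

Lemma bits_of_natE n :
  bits_of_nat n = if n == 0 then [::] else odd n :: bits_of_nat n./2.
Proof.
have bitsE p : bits_of_nat (nat_of_pos p) = bits_of_pos p.
  by rewrite /bits_of_nat -[nat_of_pos p]/(nat_of_bin (BinNums.Npos p)) nat_of_binK.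
rewrite -[n]bin_of_natK; case: (bin_of_nat n) => [|p] //=.
have pos_gt0 q : nat_of_pos q == 0 = false.
  by elim: q => //= q; rewrite NatTrec.doubleE double_eq0.
rewrite pos_gt0 bitsE; case: p => [p|p|] //=; rewrite NatTrec.doubleE.
  by rewrite odd_double uphalf_double bitsE.
by rewrite odd_double doubleK bitsE.
Qed.

Lemma bits_of_natD (b : bool) n :
  bits_of_nat (b + n.*2) = if (0 < n) || b then b :: bits_of_nat n else [::].
Proof.
rewrite bits_of_natE half_bit_double oddD odd_double addbF addn_eq0 double_eq0.
by case: b n => [] [|n].
Qed.

Definition nbits n := size (bits_of_nat n).

Lemma nbits_leq n k : (nbits n <= k) = (n < 2 ^ k).
Proof.
elim: k n => [|k IHk] n; rewrite /nbits bits_of_natE; first by case: n.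
case: eqP => [->|/eqP n0]; first by rewrite expn_gt0.
by rewrite /= ltnS [size _ <= k]IHk expnS; lia.
Qed.

Lemma ltn_nbits n : n < 2 ^ nbits n.
Proof. by rewrite -nbits_leq. Qed.

Lemma esize_bits (s : seq bool) : esize s <= 4 * size s + 1.
Proof.
by elim: s => //= b s IHs; rewrite esize_cons; move: (esize_bool b); lia.
Qed.

Lemma esize_nat_leq (n : nat) : esize n <= 4 * nbits n + 1.
Proof.
exact: (esize_bits (bits_of_nat n)).
Qed.

Lemma nbits_esize (n : nat) : nbits n < esize n.
Proof. exact: size_enc_seq. Qed.

Lemma esize_nat_ltn n k : n < 2 ^ k -> esize n <= 4 * k + 1.
Proof. by rewrite -nbits_leq; have := esize_nat_leq n; lia. Qed.

Lemma ltn_esize (n : nat) k : esize n <= k -> n < 2 ^ k.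
Proof. by rewrite -nbits_leq; have := nbits_esize n; lia. Qed.

Lemma esize_nat_mono (m n : nat) : m <= n -> esize m <= 4 * esize n + 1.
Proof.
move=> le_mn; apply: esize_nat_ltn.
exact: leq_ltn_trans le_mn (ltn_esize (leqnn _)).
Qed.

Lemma pt_is_node : polytime is_node.
Proof.
move=> b; exists (If (EVar b) (Assign b (ENode ELeaf ELeaf)) (Assign b ELeaf)).
exists (fun n => n + 20); split; first by polyb.
move=> s t sx; exists (update s b (enc (is_node t))).
case Dt: (is_node t); eexists; split.
- apply: ExecIfTrue; first by rewrite /= sx.
  exact: (@ExecAssign s b (ENode ELeaf ELeaf)).
- by rewrite /update eqxx.
- by move=> y ltyb; rewrite /update ltn_eqF.
- by rewrite /= sx /tsize -/tsize; lia.
- apply: ExecIfFalse; first by rewrite /= sx Dt.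
  exact: (@ExecAssign s b ELeaf).
- by rewrite /update eqxx.
- by move=> y ltyb; rewrite /update ltn_eqF.
- by rewrite /= sx /tsize -/tsize; lia.
Qed.

Section Bits.
Context {A : Type} {eA : Enc A}.

Lemma pt_bits (f : A -> nat) : polytime f -> polytime (fun x => bits_of_nat (f x)).
Proof. by move=> hf; apply: pt_coerce hf. Qed.

Lemma pt_half (f : A -> nat) : polytime f -> polytime (fun x => (f x)./2).
Proof.
move=> hf; apply: (pt_comp (g := half)) hf (pt_lift _ pt_ttail) => n.
rewrite /enc /enc_nat_inst /enc_nat (bits_of_natE n).
by case: eqP => [->|].
Qed.

Lemma pt_odd (f : A -> nat) : polytime f -> polytime (fun x => odd (f x)).
Proof.
move=> hf; apply: (pt_comp (g := odd)) hf (pt_lift _ pt_thead) => n.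
rewrite /enc /enc_nat_inst /enc_nat (bits_of_natE n).
by case: eqP => [->|].
Qed.

Lemma pt_lt0 (f : A -> nat) : polytime f -> polytime (fun x => 0 < f x).
Proof.
move=> hf; apply: (pt_comp (g := leq 1)) hf _.
have : polytime (fun n : nat => is_node (enc n)).
  by apply: pt_comp pt_is_node; exact: (pt_coerce (f := id)) pt_id.
apply: pt_ext => n.
by rewrite /enc /enc_nat_inst /enc_nat (bits_of_natE n) lt0n; case: eqP.
Qed.

Lemma pt_nat_of_bool (b : A -> bool) : polytime b ->
  polytime (fun x => nat_of_bool (b x)).
Proof.
by move=> hb; apply: pt_ext (pt_if hb (pt_const 1) (pt_const 0)) => x; case: (b x).
Qed.

Definition add_bit (n : nat) (b : bool) : nat := b + n.*2.

Lemma pt_add_bit (f : A -> nat) (g : A -> bool) :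
  polytime f -> polytime g -> polytime (fun x => add_bit (f x) (g x)).
Proof.
move=> hf hg; apply: (pt_coerce (f := fun x =>
  if (0 < f x) || g x then g x :: bits_of_nat (f x) else [::])) => [x|].
  by rewrite -bits_of_natD.
apply: pt_if; last by pt.
  by apply: pt_orb => //; apply: pt_lt0.
by apply: pt_cons => //; apply: pt_bits.
Qed.

End Bits.

Ltac pt_arith := fail.
Ltac pt_lemma ::= first [simple apply pt_cons | simple apply pt_andb
  | simple apply pt_orb | simple apply pt_negb | simple apply pt_addb
  | simple apply pt_some | simple apply pt_rev | simple apply pt_cat
  | simple apply pt_flatten | simple apply pt_map | simple apply pt_filter
  | simple apply pt_all | simple apply pt_has | simple apply pt_first_sat
  | simple apply pt_bits | simple apply pt_half | simple apply pt_odd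
  | simple apply pt_lt0 | simple apply pt_add_bit
  | simple apply pt_nat_of_bool | pt_arith].

(** Horner evaluation, with [s] most significant digit first and [c] as the leading part; the final
    carry of an addition enters as [c]. *)
Definition undigits (c : nat) (s : seq bool) : nat := foldl add_bit c s.

Lemma undigits_bound c s : undigits c s < c.+1 * 2 ^ size s.
Proof.
elim: s c => [|b s IHs] c; first by rewrite muln1.
apply: leq_trans (IHs _) _; rewrite /= expnS mulnA leq_mul2r /add_bit.
by case: b; apply/orP; right; lia.
Qed.

Lemma pt_undigits (A : Type) (eA : Enc A) (f : A -> nat) (g : A -> seq bool) :
  polytime f -> polytime g -> polytime (fun x => undigits (f x) (g x)).
Proof.
move=> hf hg; have [q hq le_q] := pt_size hf; have [p hp le_p] := pt_size hg.
apply: (pt_foldl (q := fun n => 4 * (q n + 1 + p n) + 1)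
  (step := fun=> add_bit)) => //.
- by polyb.
- move=> x i; apply: esize_nat_ltn.
  apply: leq_trans (undigits_bound _ _) _; rewrite !expnD leq_mul //.
    have := ltn_esize (le_q x); have : 0 < 2 ^ q (esize x) by rewrite expn_gt0.
    by lia.
  rewrite leq_exp2l //; have lt_g : size (g x) < esize (g x) by exact: size_enc_seq.
  have := le_p x.
  by rewrite size_take_min; lia.
- by pt.
Qed.

(* Serial arithmetic on a state [((a, b), (c, out))]: remaining digits, carry,
   and digits produced so far, most significant first. *)
Definition serial (carry : bool -> bool -> bool -> bool)
    (st : nat * nat * (bool * seq bool)) : nat * nat * (bool * seq bool) :=
  ((st.1.1./2, st.1.2./2),
   (carry (odd st.1.1) (odd st.1.2) st.2.1,
    (odd st.1.1 (+) odd st.1.2 (+) st.2.1) :: st.2.2)).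

(** The digit list is only a clock: being at least as long as either number, it lets both be used
    up. *)
Definition run_serial carry (a b : nat) : nat * nat * (bool * seq bool) :=
  foldl (fun st _ => serial carry st) ((a, b), (false, [::]))
    (bits_of_nat a ++ bits_of_nat b).

Lemma run_serial_inv carry (I : nat * nat * (bool * seq bool) -> Prop) a b :
  I ((a, b), (false, [::])) ->
  (forall st, I st -> I (serial carry st)) ->
  exists c out, run_serial carry a b = ((0, 0), (c, out)) /\ I ((0, 0), (c, out)).
Proof.
move=> I0 IS; rewrite /run_serial.
have a0 : a < 2 ^ size (bits_of_nat a ++ bits_of_nat b).
  by rewrite -nbits_leq size_cat leq_addr.
have b0 : b < 2 ^ size (bits_of_nat a ++ bits_of_nat b).
  by rewrite -nbits_leq size_cat leq_addl.
move: (_ ++ _) a0 b0 I0 => s; move: false [::] => c out a0 b0 I0.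
elim: s a b c out a0 b0 I0 => [|d s IHs] a b c out /= a0 b0 I0.
  by exists c, out; case: a b a0 b0 I0 => [|a] [|b].
by apply: IHs (IS _ I0) => /=; move: a0 b0; rewrite expnS; lia.
Qed.

Definition majority (a b c : bool) := (a && b) || (c && (a || b)).

Lemma pt_run_serial (A : Type) (eA : Enc A) carry (f g : A -> nat) :
  polytime (fun z : bool * bool * bool => carry z.1.1 z.1.2 z.2) ->
  polytime f -> polytime g -> polytime (fun x => run_serial carry (f x) (g x)).
Proof.
move=> hc hf hg; have [q hq le_q] := pt_size hf; have [p hp le_p] := pt_size hg.
pose I (x : A) i (st : nat * nat * (bool * seq bool)) :=
  [/\ st.1.1 <= f x, st.1.2 <= g x & size st.2.2 <= i].
rewrite /run_serial.
apply: (pt_foldl_inv (I := I) (step := fun _ st _ => serial carry st)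
  (init := fun x => ((f x, g x), (false, [::])))
  (q := fun n => 4 * q n + 4 * p n + 4 * (q n + p n) + 10)).
- by polyb.
- by [].
- by move=> x i st a _ _ [le_a le_b le_out]; split=> /=; lia.
- move=> x i [[a b] [c out]] le_i [/= le_a le_b le_out].
  have := le_q x; have := le_p x; have := esize_bool c.
  have := esize_bits out; have := esize_nat_mono le_a; have := esize_nat_mono le_b.
  move: le_i; rewrite size_cat -/(nbits _) -/(nbits _).
  have := nbits_esize (f x); have := nbits_esize (g x).
  change (esize ((a, b), (c, out))) with
    ((esize a + esize b).+1 + (esize c + esize out).+1).+1.
  by lia.
- by rewrite /serial; pt.
- by pt.
- by pt.
Qed.

Section Arithmetic.
Context {A : Type} {eA : Enc A}.
Implicit Types f g : A -> nat.

Lemma pt_addn f g : polytime f -> polytime g -> polytime (fun x => f x + g x).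
Proof.
move=> hf hg; pose run x := run_serial majority (f x) (g x).
apply: (pt_ext (f := fun x => undigits (run x).2.1 (run x).2.2)) => [x|].
  (* The remaining numbers and the carry, summed and followed by the digits produced, always
     represent the total. *)
  pose I (st : nat * nat * (bool * seq bool)) :=
    undigits (st.1.1 + st.1.2 + st.2.1) st.2.2 = f x + g x.
  have [||c [out [+ Iout]]] :=
    @run_serial_inv majority I (f x) (g x).
  - by rewrite /I /= addn0.
  - move=> [[a b] [c out]]; rewrite /I /= => <-; congr undigits.
    rewrite -[in RHS](odd_double_half a) -[in RHS](odd_double_half b) /add_bit.
    by case: (odd a) (odd b) c => [] [] []; rewrite /majority /=; lia.
  - by rewrite /run => ->.
have hrun : polytime run.
  by apply: pt_run_serial => //; rewrite /majority; pt.
by apply: pt_undigits; pt.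
Qed.

(* The carry is the borrow of the subtraction [a - b]. *)
Definition borrow (a b c : bool) := majority (~~ a) b c.

(** At every digit, [b <= a] is equivalent to the same comparison of the remaining parts with the
    borrow. So the last borrow decides the comparison, and if it is absent the digits give the
    difference; one run serves both operations. *)
Lemma run_borrow a b : exists c out,
  run_serial borrow a b = ((0, 0), (c, out)) /\
  (b <= a) = ~~ c /\ (~~ c -> undigits 0 out = a - b).
Proof.
pose I (st : nat * nat * (bool * seq bool)) :=
  (b <= a) = (st.1.2 + st.2.1 <= st.1.1) /\
  (st.1.2 + st.2.1 <= st.1.1 ->
     undigits (st.1.1 - (st.1.2 + st.2.1)) st.2.2 = a - b).
have [||c [out [-> [/= Ile Iout]]]] := @run_serial_inv borrow I a b.
- by rewrite /I /= addn0.
- move=> [[a' b'] [c out]]; rewrite /I /= => -[-> h].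
  move: (odd_double_half a') (odd_double_half b') h.
  move: (odd a') (a'./2) (odd b') (b'./2) => x p y q <- <-.
  have -> : (q + borrow x y c <= p) = (y + q.*2 + c <= x + p.*2).
    by case: x y c => [] [] []; rewrite /borrow /majority /=; lia.
  move=> h; split=> // le_b; rewrite -h //; congr undigits; move: le_b.
  by rewrite /add_bit; case: x y c {h} => [] [] [];
    rewrite /borrow /majority /=; lia.
exists c, out; split=> //; move: Ile Iout; rewrite add0n leqn0.
by case: c => //= -> h; split=> // _; rewrite -h.
Qed.

Lemma pt_run_borrow f g :
  polytime f -> polytime g -> polytime (fun x => run_serial borrow (f x) (g x)).
Proof.
by move=> hf hg; apply: pt_run_serial => //; rewrite /borrow /majority; pt.
Qed.

Lemma pt_leq f g : polytime f -> polytime g -> polytime (fun x => f x <= g x).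
Proof.
move=> hf hg; have := pt_run_borrow hg hf => hr.
apply: (pt_ext (f := fun x => ~~ (run_serial borrow (g x) (f x)).2.1)).
  by move=> x; have [c [out [-> [-> _]]]] := run_borrow (g x) (f x).
by pt.
Qed.

Lemma pt_subn f g : polytime f -> polytime g -> polytime (fun x => f x - g x).
Proof.
move=> hf hg; have := pt_run_borrow hf hg => hr.
apply: (pt_ext (f := fun x => if (run_serial borrow (f x) (g x)).2.1 then 0
                  else undigits 0 (run_serial borrow (f x) (g x)).2.2)).
  move=> x; have [c [out [-> [/=]]]] := run_borrow (f x) (g x).
  by case: c => //= [/negbT|_ ->] //; lia.
by apply: pt_if; [pt|pt|apply: pt_undigits; pt].
Qed.

Lemma pt_eqn f g : polytime f -> polytime g -> polytime (fun x => f x == g x).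
Proof.
move=> hf hg; apply: (pt_ext (f := fun x => (f x <= g x) && (g x <= f x))).
  by move=> x; rewrite eqn_leq.
by apply: pt_andb; apply: pt_leq.
Qed.

End Arithmetic.

Ltac pt_more := fail.
Ltac pt_arith ::= first [simple apply pt_addn | simple apply pt_leq
  | simple apply pt_subn | simple apply pt_eqn | pt_more].

(** Horner's scheme in the digits of [a]; [add_bit acc false] doubles. *)
Lemma muln_bits a b :
  foldr (fun (d : bool) acc => (if d then b else 0) + add_bit acc false) 0
    (bits_of_nat a) = a * b.
Proof.
have [n] := ubnP a; elim: n a => // n IHn a lt_an.
rewrite bits_of_natE; case: eqP => [->//|a0] /=; rewrite IHn; last lia.
rewrite /add_bit -[in RHS](odd_double_half a) mulnDl doubleMl.
by case: (odd a); rewrite ?mul1n.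
Qed.

Lemma nbits_mul a b : nbits (a * b) <= nbits a + nbits b.
Proof.
rewrite nbits_leq expnD; have := ltn_nbits a; have := ltn_nbits b; nia.
Qed.

Lemma pt_muln {A : Type} {eA : Enc A} (f g : A -> nat) :
  polytime f -> polytime g -> polytime (fun x => f x * g x).
Proof.
move=> hf hg; have [q hq le_q] := pt_size hf; have [p hp le_p] := pt_size hg.
apply: (pt_ext (fun x => muln_bits (f x) (g x))).
apply: (pt_foldr (q := fun n => 4 * (q n + p n) + 1)
  (step := fun x d acc => (if d then g x else 0) + add_bit acc false)
  (init := fun=> 0)) => //.
- by polyb.
(* Dropping low digits divides by a power of two, so each partial result is itself a product, no
   larger than the final one. *)
- move=> x i; have -> : drop i (bits_of_nat (f x)) = bits_of_nat (f x %/ 2 ^ i).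
    elim: i (f x) => [|i IHi] n; first by rewrite drop0 expn0 divn1.
    rewrite bits_of_natE expnS divnMA divn2 -IHi.
    by case: eqP => [->|].
  rewrite muln_bits; apply: leq_trans (esize_nat_leq _) _.
  rewrite leq_add2r leq_mul2l /=; apply: leq_trans (nbits_mul _ _) _.
  have le_f : nbits (f x %/ 2 ^ i) <= nbits (f x).
    by rewrite nbits_leq; apply: leq_ltn_trans (leq_div _ _) (ltn_nbits _).
  have := le_q x; have := le_p x.
  have := nbits_esize (f x); have := nbits_esize (g x); lia.
- by pt.
- by pt.
Qed.

Ltac pt_arith ::= first [simple apply pt_addn | simple apply pt_leq
  | simple apply pt_subn | simple apply pt_eqn | simple apply pt_muln | pt_more].

Section BigNat.
Context {A B : Type} {eA : Enc A} {eB : Enc B}.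
Variables (F : A -> B -> nat) (l : A -> seq B).
Hypotheses (hF : polytime (fun z : A * B => F z.1 z.2)) (hl : polytime l).

Lemma esize_in (T : eqType) (eT : Enc T) (a : T) (s : seq T) :
  a \in s -> esize a <= esize s.
Proof.
elim: s => //= b s IHs; rewrite in_cons esize_cons => /predU1P[->|/IHs]; lia.
Qed.

(* Both the sum and the product of at most [n] numbers with at most [k] bits
   are below [2 ^ ((k + 1) * n)]. *)
Lemma pt_big (op : nat -> nat -> nat) (idx : nat) :
  polytime (fun z : nat * nat => op z.1 z.2) -> idx <= 1 ->
  (forall a b k m, a < 2 ^ k -> b < 2 ^ m -> op a b < 2 ^ (k + m).+1) ->
  polytime (fun x => \big[op/idx]_(b <- l x) F x b).
Proof.
move=> hop le_idx op_lt; have [p hp le_p] := pt_size hF.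
have [q hq le_q] := pt_size hl.
apply: (pt_ext (f := fun x => foldr (fun b acc => op (F x b) acc) idx (l x))).
  by move=> x; rewrite unlock.
apply: (pt_foldr (q := fun n => 4 * ((p (n + q n + 1) + 1) * q n + 1) + 1)
  (step := fun x b acc => op (F x b) acc) (init := fun=> idx)) => //.
- by polyb.
- move=> x i; have le_r := leq_trans (esize_drop i (l x)) (le_q x).
  apply: esize_nat_ltn; move: (drop i (l x)) le_r => r le_r.
  set k := p _; have le_k b : esize b <= q (esize x) -> F x b < 2 ^ k.
    move=> le_b; apply: ltn_esize; apply: leq_trans (le_p (x, b)) (hp.1 _ _ _).
    by change (esize (x, b)) with (esize x + esize b).+1; lia.
  have [m le_rm le_mq] : exists2 m, size r <= m & m < q (esize x).
    exists (size r) => //; apply: leq_trans le_r; exact: size_enc_seq.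
  apply: (@leq_trans (2 ^ ((k + 1) * m + 1))); last by rewrite leq_exp2l; nia.
  clear le_mq; elim: r m le_rm le_r => [|b r IHr] m le_rm.
    move=> _ /=; apply: leq_trans (_ : 2 <= _); first by [].
    by rewrite addn1 expnS leq_pmulr // expn_gt0.
  case: m le_rm => // m le_rm; rewrite esize_cons => le_r.
  rewrite [foldr _ _ _]/=;
    apply: leq_trans (op_lt _ _ _ _ (le_k _ _) (IHr m _ _)) _ => //; try lia.
  by rewrite leq_exp2l // mulnS; lia.
- by pt.
- by pt.
Qed.

Lemma pt_sum : polytime (fun x => \sum_(b <- l x) F x b).
Proof.
apply: pt_big => //; first by pt.
move=> a b k m lt_a lt_b; rewrite expnS expnD.
have : 0 < 2 ^ k by rewrite expn_gt0.
have : 0 < 2 ^ m by rewrite expn_gt0.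
by nia.
Qed.

Lemma pt_prod : polytime (fun x => \prod_(b <- l x) F x b).
Proof.
apply: pt_big => //; first by pt.
move=> a b k m lt_a lt_b; rewrite expnS expnD; nia.
Qed.

End BigNat.

Ltac pt_arith ::= first [simple apply pt_addn | simple apply pt_leq
  | simple apply pt_subn | simple apply pt_eqn | simple apply pt_muln
  | simple apply pt_sum | simple apply pt_prod | pt_more].

(** * The Hungarian method *)

Lemma first_satP (T : eqType) (P : pred T) s d :
  has P s -> P (first_sat P s d) /\ first_sat P s d \in s.
Proof.
elim: s => //= b s IHs; case: ifP => [Pb _|_ /= /IHs [h1 h2]].
  by rewrite Pb mem_head.
by rewrite in_cons h1 h2 orbT.
Qed.

Lemma first_sat_mem (T : eqType) (P : pred T) s d : first_sat P s d \in d :: s.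
Proof.
elim: s => [|b s IHs] /=; first exact: mem_head.
by move: IHs; rewrite !in_cons; case: ifP => _;
  [rewrite eqxx orbT|case/orP=> ->; rewrite ?orbT].
Qed.

Notation table := (seq (nat * nat)).

Definition lookup (t : table) (k : nat) : nat :=
  (first_sat (fun e => e.1 == k) t (k, 0)).2.

Definition tabulate (X : seq nat) (f : nat -> nat) : table :=
  [seq (i, f i) | i <- X].

Lemma lookup_tabulate X f k : k \in X -> lookup (tabulate X f) k = f k.
Proof.
move=> kX; rewrite /lookup; set e := first_sat _ _ _.
have [|/eqP ek] := @first_satP _ (fun e : nat * nat => e.1 == k)
  (tabulate X f) (k, 0).
  by apply/hasP; exists (k, f k) => //; exact: map_f.
by rewrite -/e in ek * => /mapP[i _ De]; rewrite De -ek De.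
Qed.

Lemma seq_min (T : eqType) (key : T -> nat) (s : seq T) :
  s != [::] -> exists2 b, b \in s & all (fun c => key b <= key c) s.
Proof.
elim: s => // a [|c s] IHs _; first by exists a; rewrite ?mem_head //= leqnn.
have [//|b bs bmin] := IHs.
have [le_ab|lt_ba] := leqP (key a) (key b).
  exists a; rewrite ?mem_head //=; rewrite leqnn.
  by apply: sub_all bmin => x; exact: leq_trans.
exists b; first by rewrite in_cons bs orbT.
by apply/andP; split; [exact: ltnW | exact: bmin].
Qed.

(* [(done, res), ((u, p), (L, T))]: [u] and [p] are the row potentials and
   column prices, [T] lists the columns reached so far, and [L] pairs each
   reached row [s] with a permutation tight on all processed rows but [s]. *)
Notation search_state :=
  ((bool * table) * ((table * table) * (seq (nat * table) * seq nat)))%type.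

Section Hungarian.
Variables (X : seq nat) (w : nat -> nat -> nat).

(** The usual dual variable of column [j] is minus [lookup p j]; thus all stored numbers are
    natural, and rows and columns are raised alike. Under [dual_feasible] the truncated subtraction
    is exact. *)
Definition reduced (u p : table) (i j : nat) : nat :=
  w i j + lookup p j - lookup u i.

Definition candidates (L : seq (nat * table)) (T : seq nat) :
    seq (nat * table * nat) :=
  flatten [seq [seq (l, j) | j <- [seq j <- X | j \notin T]] | l <- L].

Definition best (u p : table) L T : nat * table * nat :=
  first_sat (fun c => all (fun c' =>
    reduced u p c.1.1 c.2 <= reduced u p c'.1.1 c'.2)
                          (candidates L T))
    (candidates L T) ((0, [::]), 0).

Definition raise (t : table) (S : seq nat) (delta : nat) : table :=
  tabulate X (fun a => if a \in S then lookup t a + delta else lookup t a).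

Definition holder (t : table) (j : nat) : nat :=
  first_sat (fun a => lookup t a == j) X 0.

(** Rows [s] and [holder t j] exchange columns, so a permutation stays one; if [s] already holds
    [j], nothing changes. *)
Definition reroute (t : table) (s j : nat) : table :=
  tabulate X (fun a => if a == holder t j then lookup t s
                       else if a == s then j else lookup t a).

(** The exchange leaves only the former holder of [j] possibly not tight. This is harmless if that
    row is not in [D], or is [s], whose edge to [j] has just become tight; the search then ends, and
    later rounds are idle. *)
Definition search_step (D : seq nat) (st : search_state) : search_state :=
  if st.1.1 then st else
  let u := st.2.1.1 in let p := st.2.1.2 in
  let L := st.2.2.1 in let T := st.2.2.2 in
  let b := best u p L T in
  let s := b.1.1 in let t := b.1.2 in let j := b.2 in
  let delta := reduced u p s j in
  let u' := raise u (map fst L) delta in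
  let p' := raise p T delta in
  let t' := reroute t s j in
  if (holder t j \in D) && (holder t j != s)
  then ((false, st.1.2), ((u', p'), ((holder t j, t') :: L, j :: T)))
  else ((true, t'), ((u', p'), (L, T))).

(** [X] serves as a clock: a round that does not end the search reaches a new column. *)
Definition search (D : seq nat) (i : nat) (u p t : table) : search_state :=
  foldl (fun st _ => search_step D st)
    ((false, t), ((u, p), ([:: (i, t)], [::]))) X.

Definition phase (st : seq nat * ((table * table) * table)) (i : nat) :
    seq nat * ((table * table) * table) :=
  let fin := search (i :: st.1) i st.2.1.1 st.2.1.2 st.2.2 in
  (i :: st.1, (fin.2.1, fin.1.2)).

Definition hungarian : table :=
  (foldl phase ([::], ((tabulate X (fun=> 0), tabulate X (fun=> 0)),
                       tabulate X id)) X).2.2.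

Hypothesis uniqX : uniq X.

Definition permutes (f : nat -> nat) : Prop :=
  (forall a, a \in X -> f a \in X) /\ {in X &, injective f}.

Lemma permutes_perm f : permutes f -> perm_eq (map f X) X.
Proof.
move=> [fX finj]; have u : uniq (map f X) by rewrite map_inj_in_uniq.
apply: uniq_perm => //.
have sub : {subset map f X <= X} by move=> _ /mapP[a aX ->]; exact: fX.
by have [] := uniq_min_size u sub; rewrite ?size_map.
Qed.

Lemma permutes_surj f j : permutes f -> j \in X -> exists2 a, a \in X & f a = j.
Proof.
move=> /permutes_perm/perm_mem <- /mapP[a aX ->]; by exists a.
Qed.

Lemma holderP t j : permutes (lookup t) -> j \in X ->
  holder t j \in X /\ lookup t (holder t j) = j.
Proof.
move=> pt jX; have [a aX fa] := permutes_surj pt jX.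
have [|/eqP] := @first_satP _ (fun a => lookup t a == j) X 0.
  by apply/hasP; exists a; rewrite ?fa.
by [].
Qed.

Definition dual_feasible u p :=
  {in X &, forall a j, lookup u a <= w a j + lookup p j}.

Definition tight u p a j := lookup u a = w a j + lookup p j.

(** [c0] is the column held by the new row before the search, [sigma] the permutation at that time.
    Every exchange hands [c0] on to the newly reached row, and [c0] never enters [T]; the size [n]
    of [T] counts the rounds and thereby limits the search. *)
Definition search_inv (D : seq nat) (c0 : nat) (sigma : table) (n : nat)
    (st : search_state) : Prop :=
  let u := st.2.1.1 in let p := st.2.1.2 in
  let L := st.2.2.1 in let T := st.2.2.2 in
  let S := map fst L in
  dual_feasible u p /\
  if st.1.1 then
    permutes (lookup st.1.2) /\
    {in D, forall a, tight u p a (lookup st.1.2 a)}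
  else
    [/\ uniq T, size T = n, {subset T <= X}, c0 \notin T & 0 < size L] /\
    forall l, l \in L ->
      [/\ l.1 \in D, permutes (lookup l.2) & lookup l.2 l.1 = c0] /\
      [/\ {in D, forall a, a != l.1 -> tight u p a (lookup l.2 a)},
          {in X, forall a, a != l.1 -> (lookup l.2 a \in T) = (a \in S)}
        & {in X, forall a, a \notin S -> lookup l.2 a = lookup sigma a}].

Lemma candidatesP L T l j :
  ((l, j) \in candidates L T) = [&& l \in L, j \in X & j \notin T].
Proof.
apply/flatten_mapP/and3P => [[l' l'L /mapP[j']]|[lL jX jT]].
  by rewrite mem_filter => /andP[jT jX] [-> ->].
by exists l => //; apply: map_f; rewrite mem_filter jT.
Qed.

Lemma bestP u p L T l j : l \in L -> j \in X -> j \notin T ->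
  [/\ (best u p L T).1 \in L, (best u p L T).2 \in X, (best u p L T).2 \notin T
    & forall l' j', l' \in L -> j' \in X -> j' \notin T ->
        reduced u p (best u p L T).1.1 (best u p L T).2 <= reduced u p l'.1 j'].
Proof.
move=> lL jX jT; set cs := candidates L T.
have cs0 : (l, j) \in cs by rewrite candidatesP lL jX.
pose key (c : nat * table * nat) := reduced u p c.1.1 c.2.
have [|/allP bmin] := @first_satP _ (fun c => all (fun c' => key c <= key c') cs)
  cs ((0, [::]), 0).
  by apply/hasP; apply: seq_min; case: (cs) cs0.
rewrite -/(best u p L T) => bin.
have := bin; rewrite [best _ _ _ _]surjective_pairing candidatesP.
move=> /and3P[bL bX bT]; split=> // l' j' l'L j'X j'T.
by apply: (bmin (l', j')); rewrite candidatesP l'L j'X.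
Qed.

Lemma lookup_raise t S delta a : a \in X ->
  lookup (raise t S delta) a =
  if a \in S then lookup t a + delta else lookup t a.
Proof. by move=> aX; rewrite lookup_tabulate. Qed.

(** Raising by the least reduced cost preserves feasibility, makes the edge from [s] to [j] tight
    and keeps tight edges within the reached part and within the unreached part tight. The exchange
    therefore transfers the only defect from [s] to [h]. *)
Lemma search_step_inv D c0 sigma n st :
  {subset D <= X} -> c0 \in X -> permutes (lookup sigma) ->
  search_inv D c0 sigma n st -> search_inv D c0 sigma n.+1 (search_step D st).
Proof.
case: st => [[done res] [[u p] [L T]]] DX c0X psigma.
rewrite /search_step /search_inv /=; case: done => [//|] /=.
move=> [feas [[uT sT TX c0T L0] HL]].
have [l0 l0L] : exists l, l \in L by case: (L) L0 => // l s _; exists l;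
  exact: mem_head.
have [bL jX jT bmin] := bestP u p l0L c0X c0T.
set b := best u p L T in bL jX jT bmin *.
set s := b.1.1 in bmin *; set t := b.1.2; set j := b.2 in jX jT bmin *.
set delta := reduced u p s j.
have [[sD pt ts] [tight_t tT tsigma]] := HL _ bL;
  rewrite -/s -/t in sD pt ts tight_t tT tsigma.
have sX := DX _ sD.
have sS : s \in map fst L by apply/mapP; exists b.1.
have deltaE : w s j + lookup p j = lookup u s + delta.
  by rewrite /delta /reduced subnKC // feas.
have delta_min a j' : a \in map fst L -> j' \in X -> j' \notin T ->
    lookup u a + delta <= w a j' + lookup p j'.
  move=> /mapP[l lL ->] j'X j'T.
  have l1X : l.1 \in X by have [[/DX]] := HL _ lL.
  by rewrite -(subnKC (feas _ _ l1X j'X)) leq_add2l; exact: bmin.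
have [] := holderP pt jX; set h := holder t j => hX th.
set u' := raise u _ _; set p' := raise p _ _.
have feas' : dual_feasible u' p'.
  move=> a j' aX j'X; rewrite !lookup_raise //.
  have := feas a j' aX j'X.
  case: ifP => aS; case: ifP => j'T //.
  - by rewrite addnA leq_add2r.
  - by move=> _; apply: delta_min; rewrite ?j'T.
  - by rewrite addnA => le; exact: leq_trans le (leq_addr _ _).
(* a tight edge stays tight if its two ends are both reached or both not *)
have tight' a j' : a \in X -> j' \in X -> (j' \in T) = (a \in map fst L) ->
    tight u p a j' -> tight u' p' a j'.
  move=> aX j'X eqT; rewrite /tight !lookup_raise // eqT => ->.
  by case: ifP => _; rewrite ?addnA.
have tight_sj : tight u' p' s j.
  by rewrite /tight !lookup_raise // sS (negbTE jT).
have ttX a : a \in X -> lookup t a \in X by exact: pt.1.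
have tinj := pt.2.
set t' := reroute t s j.
have t'E a : a \in X -> lookup t' a =
    if a == h then lookup t s else if a == s then j else lookup t a.
  by move=> aX; rewrite lookup_tabulate.
have pt' : permutes (lookup t').
  split=> [a aX|a1 a2 a1X a2X]; rewrite !t'E //.
    by case: ifP => _; [exact: ttX|case: ifP => _ //; exact: ttX].
  have [->|a1h] := eqVneq a1 h; have [->|a2h] := eqVneq a2 h => //.
  - case: ifP => [/eqP -> jE|a2s /tinj E].
      by apply: tinj => //; rewrite th.
    by rewrite E // eqxx in a2s.
  - case: ifP => [/eqP -> jE|a1s /tinj E].
      by apply: tinj => //; rewrite th.
    by rewrite -E // eqxx in a1s.
  - case: ifP => [/eqP ->|a1s]; case: ifP => [/eqP -> //|a2s].
    + by rewrite -th => /tinj E; rewrite -E ?eqxx in a2h.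
    + by rewrite -th => /tinj E; rewrite E ?eqxx in a1h.
    + exact: tinj.
have tight_t' a : a \in D -> a != h -> tight u' p' a (lookup t' a).
  move=> aD ah; have aX := DX _ aD; rewrite t'E // (negbTE ah).
  have [->//|a_s] := eqVneq a s.
  by apply: tight' => //; [exact: ttX|exact: tT|exact: tight_t].
case: ifP => [/andP[hD hs]|hF]; split=> //=; last first.
  split=> // a aD; have [ah|] := eqVneq a h; last exact: tight_t'.
  move: hF; rewrite -ah aD /= => /negbFE/eqP hs.
  have tsj : lookup t s = j by rewrite -hs ah.
  by rewrite ah t'E // eqxx tsj -ah hs; exact: tight_sj.
(* In [t] the reached rows other than [s] hold reached columns, and [j] is not reached. *)
have hS : h \notin map fst L.
  by rewrite -(tT _ hX hs) th.
have hsig : lookup sigma h = j by rewrite -(tsigma _ hX hS).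
have jc0 : c0 != j by apply: contraNneq hs => E; apply/eqP/tinj; rewrite // th ts.
split.
  split; rewrite ?in_cons ?uT ?jT ?sT ?negb_or ?c0T ?andbT //=.
  by move=> x; rewrite in_cons => /predU1P[->|/TX].
(* An older table still agrees with [sigma] at the unreached row [h], so it also assigns [j] to [h];
   reaching both together preserves the correspondence. *)
have old_T a (f : nat -> nat) : permutes f -> a \in X ->
    (forall a, a \in X -> a \notin map fst L -> f a = lookup sigma a) ->
    (f a \in T) = (a \in map fst L) ->
    (f a \in j :: T) = (a \in h :: map fst L).
  move=> [_ finj] aX fsig fT; rewrite !in_cons fT.
  case aS: (a \in map fst L); rewrite ?orbT // !orbF.
  have fh : f h = j by rewrite fsig.
  by apply/eqP/eqP => [E|->//]; apply: finj; rewrite ?fh.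
move=> l; rewrite in_cons => /predU1P[->|lL] /=.
  split; split=> //.
  - by rewrite t'E // eqxx.
  - move=> a aX ah; rewrite t'E // (negbTE ah) !in_cons (negbTE ah) /=.
    have [->|a_s] := eqVneq a s; first by rewrite eqxx sS.
    have -> : (lookup t a == j) = false.
      by apply: contraNF ah => /eqP E; apply/eqP/tinj; rewrite // th.
    by rewrite tT.
  - move=> a aX; rewrite in_cons negb_or => /andP[ah aS].
    rewrite t'E // (negbTE ah); case: eqP => [E|_]; last exact: tsigma.
    by rewrite E sS in aS.
have [[lD pl lc0] [tight_l lT lsig]] := HL _ lL.
split; split=> //.
- move=> a aD al; have aX := DX _ aD.
  by apply: tight' (lT _ aX al) (tight_l _ aD al) => //; exact: pl.1.
- by move=> a aX al; apply: old_T => //; exact: lT.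
- by move=> a aX; rewrite in_cons negb_or => /andP[_ /lsig]; exact.
Qed.

Lemma searchP D i u p t :
  {subset D <= X} -> i \in X -> dual_feasible u p -> permutes (lookup t) ->
  {in D, forall a, tight u p a (lookup t a)} ->
  let st := search (i :: D) i u p t in
  [/\ dual_feasible st.2.1.1 st.2.1.2, permutes (lookup st.1.2)
    & {in i :: D, forall a, tight st.2.1.1 st.2.1.2 a (lookup st.1.2 a)}].
Proof.
move=> DX iX feas pt tightD.
have DX' : {subset i :: D <= X} by move=> a; rewrite in_cons => /predU1P[->|/DX].
have c0X : lookup t i \in X by exact: pt.1.
have inv r n st : search_inv (i :: D) (lookup t i) t n st ->
    search_inv (i :: D) (lookup t i) t (n + size r)
      (foldl (fun st (_ : nat) => search_step (i :: D) st) st r).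
  elim: r n st => [|x r IHr] n st; first by rewrite addn0.
  by move=> /(search_step_inv DX' c0X pt)/IHr; rewrite addSnnS.
have /(inv X) : search_inv (i :: D) (lookup t i) t 0
    ((false, t), ((u, p), ([:: (i, t)], [::]))).
  split=> //=; split=> // l; rewrite inE => /eqP -> /=.
  split; first by split; rewrite ?mem_head.
  split=> // a; first by rewrite in_cons => /predU1P[->|/tightD //]; rewrite eqxx.
  by move=> _ /negbTE; rewrite inE => ->.
rewrite /= -/(search _ i u p t);
  case: (search _ _ _ _ _) => [[done res] [[u' p'] [L T]]].
rewrite /search_inv add0n /=;
  case: done => [[feas' [pres tres]]|[_ [[uT sT TX c0T _] _]]].
  by split.
(* An unfinished search would have collected as many columns as [X] has, all different from the
   initial column of [i]. *)
have uc : uniq (lookup t i :: T) by rewrite /= c0T.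
have sub : {subset lookup t i :: T <= X} by move=> x;
  rewrite in_cons => /predU1P[->|/TX].
by have := uniq_leq_size uc sub; rewrite /= sT ltnn.
Qed.

(** Weak duality: along any permutation, weights plus prices are at least the row potentials, with
    equality when all its edges are tight; and the prices have the same total along all
    permutations. *)
Lemma hungarianP :
  permutes (lookup hungarian) /\
  forall f, permutes f ->
    \sum_(a <- X) w a (lookup hungarian a) <= \sum_(a <- X) w a (f a).
Proof.
pose inv (st : seq nat * ((table * table) * table)) :=
  [/\ {subset st.1 <= X}, dual_feasible st.2.1.1 st.2.1.2, permutes (lookup st.2.2)
    & {in st.1, forall a, tight st.2.1.1 st.2.1.2 a (lookup st.2.2 a)}].
have invP r st : {subset r <= X} -> inv st -> inv (foldl phase st r) /\
    {subset r ++ st.1 <= (foldl phase st r).1}.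
  elim: r st => [|i r IHr]; first by move=> st _ h; split.
  move=> [D [[u p] t]] rX [/= DX feas pt tightD].
  have iX : i \in X by apply: rX; exact: mem_head.
  have [||inv' sub'] := IHr (phase (D, ((u, p), t)) i).
  - by move=> a ar; apply: rX; rewrite in_cons ar orbT.
  - have [feas' pt' tight'] := searchP DX iX feas pt tightD.
    by split=> // a; rewrite in_cons => /predU1P[->|/DX].
  - split=> // a; rewrite in_cons mem_cat => h; apply: sub'.
    by rewrite mem_cat in_cons orbCA.
have [|] := invP X ([::], ((tabulate X (fun=> 0), tabulate X (fun=> 0)), tabulate X id)) (fun _ => id).
  split=> //=; first by move=> a j aX jX; rewrite lookup_tabulate.
  by split=> [a aX|a b aX bX]; rewrite !lookup_tabulate.
rewrite /hungarian; case: (foldl _ _ _) => [D [[u p] t]] [/= DX feas pt tightD] sub.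
split=> // f pf; rewrite -(leq_add2r (\sum_(a <- X) lookup p a)).
have sump g : permutes g -> \sum_(a <- X) lookup p a = \sum_(a <- X) lookup p (g a).
  by move=> /permutes_perm pg; rewrite -(perm_big _ pg) big_map.
rewrite {1}(sump _ pt) (sump _ pf) -!big_split /= (eq_big_seq (lookup u)).
  by rewrite !big_seq leq_sum // => a aX; apply: feas => //; exact: pf.1.
by move=> a aX; apply/esym/tightD/sub; rewrite cats0.
Qed.

End Hungarian.

(** * Bit sizes during the search *)

Lemma nbits_mono m n : m <= n -> nbits m <= nbits n.
Proof. by move=> le_mn; rewrite nbits_leq (leq_ltn_trans le_mn) ?ltn_nbits. Qed.

Lemma nbits_add k m n : nbits m <= k -> nbits n <= k -> nbits (m + n) <= k.+1.
Proof. by rewrite !nbits_leq expnS; lia. Qed.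

Lemma esize_seq_leq (T : eqType) (eT : Enc T) (s : seq T) m :
  {in s, forall a, esize a <= m} -> esize s <= size s * m.+1 + 1.
Proof.
elim: s => // a s IHs hm; rewrite esize_cons /= mulSn.
have ha : esize a <= m by apply: hm; exact: mem_head.
have hs : esize s <= size s * m.+1 + 1.
  by apply: IHs => b bs; apply: hm; rewrite in_cons bs orbT.
by lia.
Qed.

(** [K] bounds the bits of vertex numbers, [V] those of the stored values, [M] the number of
    entries. For permutation tables the values are vertices, and [V] is [K]. *)
Definition table_ok (K V M : nat) (t : table) : Prop :=
  size t <= M /\ {in t, forall e : nat * nat, nbits e.1 <= K /\ nbits e.2 <= V}.

Lemma table_okW K V V' M t : V <= V' -> table_ok K V M t -> table_ok K V' M t.
Proof.
by move=> leV [sz ok]; split=> // e /ok[h1 h2]; split=> //; exact: leq_trans leV.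
Qed.

Lemma lookup_ok K V M t a : table_ok K V M t -> nbits (lookup t a) <= V.
Proof.
move=> [_ ok]; rewrite /lookup;
  have := @first_sat_mem _ (fun e : nat * nat => e.1 == a) t (a, 0).
by rewrite in_cons => /predU1P[->|/ok[]].
Qed.

Lemma esize_entry (e : nat * nat) k v :
  nbits e.1 <= k -> nbits e.2 <= v -> esize e <= 4 * k + 4 * v + 3.
Proof.
change (esize e) with (esize e.1 + esize e.2).+1.
by have := esize_nat_leq e.1; have := esize_nat_leq e.2; lia.
Qed.

Lemma nbits_entry (e : nat * nat) :
  nbits e.1 <= esize e /\ nbits e.2 <= esize e.
Proof.
change (esize e) with (esize e.1 + esize e.2).+1.
by have := nbits_esize e.1; have := nbits_esize e.2; lia.
Qed.

Definition table_bound N := N * (8 * N + 5) + 1.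

Lemma table_ok_size N K V M t :
  K <= N -> V <= N -> M <= N -> table_ok K V M t -> esize t <= table_bound N.
Proof.
move=> leK leV leM [sz ok].
have le_e : {in t, forall e : nat * nat, esize e <= 8 * N + 3}.
  by move=> e /ok[h1 h2]; apply: leq_trans (esize_entry h1 h2) _; lia.
apply: leq_trans (esize_seq_leq le_e) _; rewrite leq_add2r.
by apply: leq_mul; [exact: leq_trans leM|lia].
Qed.

Lemma esize_table_ok (t : table) : table_ok (esize t) (esize t) (esize t) t.
Proof.
split=> [|e et]; first by apply: ltnW; exact: size_enc_seq.
have le_e : esize e <= esize t by exact: esize_in.
by have [h1 h2] := nbits_entry e; split; exact: leq_trans le_e.
Qed.

Section Bounds.
Variables (X : seq nat) (w : nat -> nat -> nat) (K M : nat).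
Hypotheses (XK : {in X, forall a : nat, nbits a <= K}) (XM : size X <= M).

Definition state_ok (V n : nat) (st : search_state) : Prop :=
  [/\ table_ok K K M st.1.2, table_ok K V M st.2.1.1 & table_ok K V M st.2.1.2] /\
  [/\ size st.2.2.1 <= n.+1, size st.2.2.2 <= n,
      {in st.2.2.1, forall l : nat * table, nbits l.1 <= K /\ table_ok K K M l.2}
    & {in st.2.2.2, forall j : nat, nbits j <= K}].

(** Three tables, at most [N + 1] reached rows with a table each, and at most [N] reached
    columns. *)
Definition state_bound N := 3 * table_bound N +
  ((N + 1) * (table_bound N + 4 * N + 3) + (N * (4 * N + 2))) + 20.

Lemma state_ok_size N V n st :
  K <= N -> V <= N -> M <= N -> n <= N -> state_ok V n st ->
    esize st <= state_bound N.
Proof.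
clear XK XM; case: st => [[done res] [[u p] [L T]]] leK leV leM len.
move=> [/= [ok_res ok_u ok_p] [szL szT okL okT]].
have hres := table_ok_size leK leK leM ok_res.
have hu := table_ok_size leK leV leM ok_u.
have hp := table_ok_size leK leV leM ok_p.
have le_l : {in L, forall l : nat * table, esize l <= table_bound N + 4 * N + 2}.
  move=> [i t] /okL[/= h1 /(table_ok_size leK leK leM) h2].
  change (esize (i, t)) with (esize i + esize t).+1.
  apply: leq_ltn_trans (leq_add (esize_nat_leq i) h2) _; lia.
have le_j : {in T, forall j : nat, esize j <= 4 * N + 1}.
  by move=> j /okT h; apply: leq_trans (esize_nat_leq j) _; lia.
have hL := esize_seq_leq le_l; have hT := esize_seq_leq le_j.
have hd := esize_bool done.
change (esize ((done, res), ((u, p), (L, T)))) with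
  ((esize done + esize res).+1 +
   ((esize u + esize p).+1 + (esize L + esize T).+1).+1).+1.
have hL' : esize L <= (N + 1) * (table_bound N + 4 * N + 3) + 1.
  apply: leq_trans hL _; rewrite leq_add2r.
  by apply: leq_mul; [apply: leq_trans szL _|]; lia.
have hT' : esize T <= N * (4 * N + 2) + 1.
  apply: leq_trans hT _; rewrite leq_add2r.
  by apply: leq_mul; [apply: leq_trans szT _|]; lia.
by rewrite /state_bound; lia.
Qed.

Lemma tabulate_ok V f :
  {in X, forall a : nat, nbits (f a) <= V} -> table_ok K V M (tabulate X f).
Proof.
move=> fV; split; first by rewrite size_map.
by move=> _ /mapP[a aX ->] /=; split; [exact: XK|exact: fV].
Qed.

Lemma holder_ok t j : nbits (holder X t j) <= K.
Proof.
have := @first_sat_mem _ (fun a => lookup t a == j) X 0.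
by rewrite in_cons => /predU1P[|/XK //]; rewrite /holder => ->.
Qed.

Lemma raise_ok V t S delta : table_ok K V M t -> nbits delta <= V.+1 ->
  table_ok K V.+2 M (raise X t S delta).
Proof.
move=> ok_t le_d; apply: tabulate_ok => a aX; have le_t := lookup_ok a ok_t.
by case: ifP => _; [apply: nbits_add|]; lia.
Qed.

Lemma best_ok u p L T :
  {in L, forall l : nat * table, nbits l.1 <= K /\ table_ok K K M l.2} ->
  let b := best X w u p L T in
  [/\ nbits b.1.1 <= K, table_ok K K M b.1.2 & nbits b.2 <= K].
Proof.
move=> okL; rewrite /= /best; set P := fun c => all _ _; set cs := candidates X L T.
have := @first_sat_mem _ P cs ((0, [::]), 0); rewrite in_cons => /predU1P[->//|].
rewrite [first_sat _ _ _]surjective_pairing candidatesP =>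
  /and3P[/okL[h1 h2] /XK h3 _].
by split.
Qed.

(** The reduced cost is at most weight plus price, hence takes one bit more than [V]; adding it to a
    potential takes a second one. *)
Lemma search_step_ok D V n st :
  (forall a b, nbits a <= K -> nbits b <= K -> nbits (w a b) <= V) ->
  state_ok V n st -> state_ok V.+2 n.+1 (search_step X w D st).
Proof.
case: st => [[done res] [[u p] [L T]]] wV [/= [ok_res ok_u ok_p] [szL szT okL okT]].
rewrite /search_step /=; case: done => /=.
  split; split=> //=; try exact: leqW; exact: table_okW (leqW (leqnSn V)) _.
have [sK tK jK] := best_ok u p T okL.
set b := best _ _ _ _ _ _ in sK tK jK *.
set delta := reduced w u p b.1.1 b.2.
have dV : nbits delta <= V.+1.
  apply: leq_trans (nbits_mono (leq_subr _ _)) _.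
  by apply: nbits_add; [exact: wV|exact: lookup_ok ok_p].
have ok_t' : table_ok K K M (reroute X b.1.2 b.1.1 b.2).
  apply: tabulate_ok => a aX; do 2?case: ifP => _ //; exact: lookup_ok tK.
have ok_u' := raise_ok (map fst L) ok_u dV; have ok_p' := raise_ok T ok_p dV.
case: ifP => _; split=> //; split=> //=; try exact: leqW.
- by move=> l; rewrite in_cons => /predU1P[->|/okL //]; split=> //; exact: holder_ok.
- by move=> j; rewrite in_cons => /predU1P[->|/okT].
Qed.

Lemma search_ok D i u p t V r :
  (forall a b, nbits a <= K -> nbits b <= K -> nbits (w a b) <= V) ->
  nbits i <= K -> table_ok K V M u -> table_ok K V M p -> table_ok K K M t ->
  state_ok (V + 2 * size r) (size r)
    (foldl (fun st (_ : nat) => search_step X w D st)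
       ((false, t), ((u, p), ([:: (i, t)], [::]))) r).
Proof.
move=> wV iK ok_u ok_p ok_t; elim/last_ind: r => [|r a IHr].
  rewrite muln0 addn0; split=> //; split=> // l; rewrite inE => /eqP -> //.
rewrite foldl_rcons size_rcons mulnS addnA addn2 !addSn.
apply: search_step_ok IHr => a' b' a'K b'K.
by apply: leq_trans (wV _ _ a'K b'K) (leq_addr _ _).
Qed.

End Bounds.

(** * Polynomial time of the Hungarian method *)

Section PTTables.
Context {A : Type} {eA : Enc A}.

Lemma pt_mem (f : A -> nat) (l : A -> seq nat) :
  polytime f -> polytime l -> polytime (fun x => f x \in l x).
Proof.
move=> hf hl; apply: (pt_ext (f := fun x => has (fun b => b == f x) (l x))).
  by move=> x; rewrite -has_pred1; apply: eq_has.
by pt.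
Qed.

Lemma pt_lookup (t : A -> table) (k : A -> nat) :
  polytime t -> polytime k -> polytime (fun x => lookup (t x) (k x)).
Proof. by move=> ht hk; unfold lookup; pt. Qed.

Lemma pt_tabulate (X : A -> seq nat) (f : A -> nat -> nat) :
  polytime (fun z : A * nat => f z.1 z.2) -> polytime X ->
  polytime (fun x => tabulate (X x) (f x)).
Proof. by move=> hf hX; unfold tabulate; pt. Qed.

End PTTables.

Ltac pt_more ::= first [simple apply pt_mem | simple apply pt_lookup
  | simple apply pt_tabulate].

Section PTHungarian.
Context {A : Type} {eA : Enc A}.
Variables (X : A -> seq nat) (w : A -> nat -> nat -> nat).
Hypothesis hX : polytime X.
Hypothesis hw : polytime (fun z : A * nat * nat => w z.1.1 z.1.2 z.2).

Lemma pt_candidates (L : A -> seq (nat * table)) (T : A -> seq nat) :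
  polytime L -> polytime T -> polytime (fun x => candidates (X x) (L x) (T x)).
Proof. by move=> hL hT; unfold candidates; pt. Qed.

Lemma pt_reduced (u p : A -> table) (i j : A -> nat) :
  polytime u -> polytime p -> polytime i -> polytime j ->
  polytime (fun x => reduced (w x) (u x) (p x) (i x) (j x)).
Proof. by move=> hu hp hi hj; unfold reduced; pt. Qed.

Lemma pt_raise (t : A -> table) (S : A -> seq nat) (delta : A -> nat) :
  polytime t -> polytime S -> polytime delta ->
    polytime (fun x => raise (X x) (t x) (S x) (delta x)).
Proof. by move=> ht hS hd; unfold raise; pt. Qed.

Lemma pt_holder (t : A -> table) (j : A -> nat) :
  polytime t -> polytime j -> polytime (fun x => holder (X x) (t x) (j x)).
Proof. by move=> ht hj; unfold holder; pt. Qed.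

End PTHungarian.

Ltac pt_more ::= first [simple apply pt_mem | simple apply pt_lookup
  | simple apply pt_tabulate | simple apply pt_candidates
  | simple apply pt_reduced | simple apply pt_raise | simple apply pt_holder].

Section PTSearch.
Context {A : Type} {eA : Enc A}.
Variables (X : A -> seq nat) (w : A -> nat -> nat -> nat).
Hypothesis hX : polytime X.
Hypothesis hw : polytime (fun z : A * nat * nat => w z.1.1 z.1.2 z.2).

Lemma pt_reroute (t : A -> table) (s j : A -> nat) :
  polytime t -> polytime s -> polytime j ->
    polytime (fun x => reroute (X x) (t x) (s x) (j x)).
Proof. by move=> ht hs hj; unfold reroute; pt. Qed.

Lemma pt_best (u p : A -> table) (L : A -> seq (nat * table)) (T : A -> seq nat) :
  polytime u -> polytime p -> polytime L -> polytime T ->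
  polytime (fun x => best (X x) (w x) (u x) (p x) (L x) (T x)).
Proof. by move=> hu hp hL hT; unfold best; pt. Qed.

End PTSearch.

Ltac pt_more ::= first [simple apply pt_mem | simple apply pt_lookup
  | simple apply pt_tabulate | simple apply pt_candidates
  | simple apply pt_reduced | simple apply pt_raise | simple apply pt_holder
  | simple apply pt_reroute | simple apply pt_best].

Lemma pt_search_step {A : Type} {eA : Enc A} (X : A -> seq nat)
    (w : A -> nat -> nat -> nat) (D : A -> seq nat) (st : A -> search_state) :
  polytime X -> polytime (fun z : A * nat * nat => w z.1.1 z.1.2 z.2) ->
    polytime D -> polytime st ->
  polytime (fun x => search_step (X x) (w x) (D x) (st x)).
Proof. by move=> hX hw hD hst; unfold search_step; pt. Qed.

Lemma polybound_state_bound N : polybound N ->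
  polybound (fun n => state_bound (N n)).
Proof. by move=> hN; rewrite /state_bound /table_bound; polyb. Qed.

Lemma nbits_in (s : seq nat) k : esize s <= k ->
  {in s, forall a : nat, nbits a <= k}.
Proof.
move=> le_s a /= ain; apply: leq_trans (ltnW (nbits_esize a)) (leq_trans _ le_s).
exact: esize_in.
Qed.

(** A number of [k] bits is encoded in at most [4 * k + 1] nodes; two such numbers and two pairing
    nodes give [8 * k + 4]. *)
Lemma nbits_weight {A : Type} {eA : Enc A} (w : A -> nat -> nat -> nat) q :
  polybound q ->
  (forall z : A * nat * nat, esize (w z.1.1 z.1.2 z.2) <= q (esize z)) ->
  forall x a b k, nbits a <= k -> nbits b <= k ->
    nbits (w x a b) <= q (esize x + 8 * k + 4).
Proof.
move=> hq le_q x a b k le_a le_b.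
apply: leq_trans (ltnW (nbits_esize _)) (leq_trans (le_q (x, a, b)) (hq.1 _ _ _)).
change (esize (x, a, b)) with ((esize x + esize a).+1 + esize b).+1.
by have := esize_nat_leq a; have := esize_nat_leq b; lia.
Qed.

Lemma pt_search {A : Type} {eA : Enc A} (X : A -> seq nat)
    (w : A -> nat -> nat -> nat) (D : A -> seq nat) (i : A -> nat)
    (u p t : A -> table) :
  polytime X -> polytime (fun z : A * nat * nat => w z.1.1 z.1.2 z.2) ->
    polytime D -> polytime i ->
  polytime u -> polytime p -> polytime t ->
  polytime (fun x => search (X x) (w x) (D x) (i x) (u x) (p x) (t x)).
Proof.
move=> hX hw hD hi hu hp ht.
have [qX hqX le_X] := pt_size hX; have [qi hqi le_i] := pt_size hi.
have [qu hqu le_u] := pt_size hu; have [qp hqp le_p] := pt_size hp.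
have [qt hqt le_t] := pt_size ht; have [qw hqw le_w] := pt_size hw.
(* One common bound for vertex bits, table lengths and the bits of the initial potentials. *)
pose K n := qX n + qi n + qu n + qp n + qt n.
pose V n := K n + qw (n + 8 * K n + 4).
have hK : polybound K by rewrite /K; polyb.
have hV : polybound V by rewrite /V; polyb.
have XK x : {in X x, forall a : nat, nbits a <= K (esize x)}.
  by apply: nbits_in; apply: leq_trans (le_X x) _; rewrite /K; lia.
have XM x : size (X x) <= K (esize x).
  have lt_X : size (X x) < esize (X x) by exact: size_enc_seq.
  by apply: leq_trans (ltnW lt_X) (leq_trans (le_X x) _); rewrite /K; lia.
have wV x a b : nbits a <= K (esize x) -> nbits b <= K (esize x) ->
    nbits (w x a b) <= V (esize x).
  move=> ha hb; apply: leq_trans (nbits_weight hqw le_w x ha hb) _.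
  exact: leq_addl.
have tab_ok (t' : table) k : esize t' <= k -> table_ok k k k t'.
  move=> le_k; have [h1 h2] := esize_table_ok t'.
  split; first exact: leq_trans h1 le_k.
  by move=> e /h2[h3 h4]; split; exact: leq_trans le_k.
unfold search.
apply: (pt_foldl_inv (step := fun x st _ => search_step (X x) (w x) (D x) st)
  (init := fun x => ((false, t x), ((u x, p x), ([:: (i x, t x)], [::]))))
  (I := fun x m st => state_ok (K (esize x)) (K (esize x)) (V (esize x) + 2 * m) m st)
  (q := fun n => state_bound (V n + 2 * K n))).
- by apply: polybound_state_bound; polyb.
- move=> x; rewrite muln0 addn0.
  have tK : table_ok (K (esize x)) (K (esize x)) (K (esize x)) (t x).
    by apply: tab_ok; apply: leq_trans (le_t x) _; rewrite /K; lia.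
  have leKV : K (esize x) <= V (esize x) by exact: leq_addr.
  split; split=> //=.
  + apply: table_okW leKV (tab_ok _ _ _).
    by apply: leq_trans (le_u x) _; rewrite /K; lia.
  + apply: table_okW leKV (tab_ok _ _ _).
    by apply: leq_trans (le_p x) _; rewrite /K; lia.
  + move=> l; rewrite inE => /eqP -> /=; split=> //.
    apply: leq_trans (ltnW (nbits_esize _)) (leq_trans (le_i x) _).
    by rewrite /K; lia.
- move=> x m st a _ _ st_ok; rewrite mulnS addnCA addnC addn2.
  apply: search_step_ok => // a' b' ha hb; apply: leq_trans (wV x a' b' ha hb) _.
  exact: leq_addr.
- move=> x m st le_m st_ok.
  have le_mK : m <= K (esize x) by exact: leq_trans le_m (XM x).
  have leKV : K (esize x) <= V (esize x) by exact: leq_addr.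
  apply: state_ok_size st_ok; lia.
- by apply: pt_search_step; pt.
- by pt.
- by [].
Qed.

Lemma pt_hungarian {A : Type} {eA : Enc A} (X : A -> seq nat)
    (w : A -> nat -> nat -> nat) :
  polytime X -> polytime (fun z : A * nat * nat => w z.1.1 z.1.2 z.2) ->
  polytime (fun x => hungarian (X x) (w x)).
Proof.
move=> hX hw.
have [K hK le_X] := pt_size hX; have [qw hqw le_w] := pt_size hw.
pose V n := qw (n + 8 * K n + 4).
have hV : polybound V by rewrite /V; polyb.
have XK x : {in X x, forall a : nat, nbits a <= K (esize x)}.
  exact: nbits_in.
have XM x : size (X x) <= K (esize x).
  have lt_X : size (X x) < esize (X x) by exact: size_enc_seq.
  exact: leq_trans (ltnW lt_X) (le_X x).
have wV x a b : nbits a <= K (esize x) -> nbits b <= K (esize x) ->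
    nbits (w x a b) <= V (esize x).
  by move=> ha hb; apply: nbits_weight.
(* At most [K] phases of at most [K] rounds, with 2 bits for each round; the last summand makes the
   bound cover vertex bits and table lengths too. *)
pose bnd n := V n + 2 * K n * K n + K n.
unfold hungarian; apply: (pt_comp
  (g := fun st : seq nat * ((table * table) * table) => st.2.2)); last by pt.
apply: (pt_foldl_inv (step := fun x => phase (X x) (w x))
  (init := fun x => ([::], ((tabulate (X x) (fun=> 0), tabulate (X x) (fun=> 0)),
                       tabulate (X x) id)))
  (I := fun x m (st : seq nat * ((table * table) * table)) =>
    let k := K (esize x) in
    [/\ size st.1 <= m, {in st.1, forall a : nat, esize a <= k},
        table_ok k (V (esize x) + 2 * k * m) k st.2.1.1,
        table_ok k (V (esize x) + 2 * k * m) k st.2.1.2 & table_ok k k k st.2.2])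
  (q := fun n => 3 * table_bound (bnd n) + (K n * (K n + 1) + 1) + 10)).
- by rewrite /table_bound /bnd; polyb.
- move=> x; split=> //=; apply: tabulate_ok => // a aX; exact: XK.
- move=> x m [D [[u p] t]] i _ le_i [/= szD okD ok_u ok_p ok_t].
  have iK : nbits i <= K (esize x).
    apply: leq_trans (ltnW (nbits_esize _)) (leq_trans le_i (le_X x)).
  have wV' a b : nbits a <= K (esize x) -> nbits b <= K (esize x) ->
      nbits (w x a b) <= V (esize x) + 2 * K (esize x) * m.
    by move=> ha hb; apply: leq_trans (wV x a b ha hb) (leq_addr _ _).
  have := search_ok (XK x) (XM x) (i :: D) (X x) wV' iK ok_u ok_p ok_t.
  rewrite -/(search (X x) (w x) (i :: D) i u p t).
  case: (search _ _ _ _ _ _ _) =>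
    [[done res] [[u' p'] [L T]]] [/= [ok_res ok_u' ok_p'] _].
  have leV : V (esize x) + 2 * K (esize x) * m + 2 * size (X x) <=
      V (esize x) + 2 * K (esize x) * m.+1.
    by have := XM x; lia.
  split=> //.
  + move=> a; rewrite in_cons => /predU1P[->|/okD //].
    exact: leq_trans le_i (le_X x).
  + exact: table_okW leV ok_u'.
  + exact: table_okW leV ok_p'.
- move=> x m [D [[u p] t]] le_m [/= szD okD ok_u ok_p ok_t].
  have leV : V (esize x) + 2 * K (esize x) * m <= bnd (esize x).
    have le_mK : m <= K (esize x) by exact: leq_trans le_m (XM x).
    rewrite /bnd -addnA leq_add2l; apply: leq_trans _ (leq_addr _ _).
    by rewrite leq_mul2l le_mK orbT.
  have leK : K (esize x) <= bnd (esize x) by exact: leq_addl.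
  have hu := table_ok_size leK leV leK ok_u.
  have hp := table_ok_size leK leV leK ok_p.
  have ht := table_ok_size leK leK leK ok_t.
  have hD : esize D <= K (esize x) * (K (esize x) + 1) + 1.
    apply: leq_trans (esize_seq_leq okD) _; rewrite leq_add2r.
    apply: leq_mul; last by rewrite addn1.
    exact: leq_trans szD (leq_trans le_m (XM x)).
  change (esize (D, (u, p, t))) with
    (esize D + ((esize u + esize p).+1 + esize t).+1).+1.
  by lia.
- unfold phase; pt; apply: pt_search; pt.
- by pt.
- by [].
Qed.

(** * Trees and permutations *)

Section OutTree.
Variables (n : nat) (r : 'I_n).
Implicit Types (A : {set 'I_n * 'I_n}) (u v : 'I_n).

Lemma tree_vertices_arc A u v : (u, v) \in A ->
  u \in tree_vertices r A /\ v \in tree_vertices r A.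
Proof.
by move=> uvA; split; rewrite inE; apply/orP; right; apply/existsP;
  [exists v|exists u]; rewrite uvA ?orbT.
Qed.

Lemma out_tree_walk A u v : out_tree r A -> (u, v) \in A ->
  exists2 p, path (arc_rel A) r p & last r p = u.
Proof.
by move=> treeA /tree_vertices_arc[/treeA[p [[pp lp] _]] _]; exists p.
Qed.

(** The walks to [v] through [u] and through [u'] coincide, hence so do their last arcs. *)
Lemma out_tree_parent A u u' v :
  out_tree r A -> (u, v) \in A -> (u', v) \in A -> u = u'.
Proof.
move=> treeA uvA u'vA; have [p pp lp] := out_tree_walk treeA uvA.
have [q pq lq] := out_tree_walk treeA u'vA.
have [_ /treeA[w [_ uniq_w]]] := tree_vertices_arc uvA.
have wp : w = rcons p v by apply: uniq_w; rewrite rcons_path last_rcons pp lp.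
have wq : w = rcons q v by apply: uniq_w; rewrite rcons_path last_rcons pq lq.
have /rcons_inj[E] : rcons p v = rcons q v by rewrite -wp.
by rewrite -lp E lq.
Qed.

(** Otherwise a nonempty closed walk at [r] would compete with the empty one. *)
Lemma out_tree_root A u : out_tree r A -> (u, r) \notin A.
Proof.
move=> treeA; apply/negP => urA; have [p pp lp] := out_tree_walk treeA urA.
have [_ /treeA[w [_ uniq_w]]] := tree_vertices_arc urA.
have wp : w = rcons p r by apply: uniq_w; rewrite rcons_path last_rcons pp lp.
have w0 : w = [::] by apply: uniq_w.
by move: wp; rewrite w0; case: (p).
Qed.

(** Traced back from its end, a walk from [r] is determined: parents are unique, and it can only
    stop at [r], which has none. The third condition excludes arcs, such as those of a separate
    cycle, that [r] does not reach. *)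
Lemma out_tree_intro A :
  (forall u u' v, (u, v) \in A -> (u', v) \in A -> u = u') ->
  (forall u, (u, r) \notin A) ->
  (forall u v, (u, v) \in A -> connect (arc_rel A) r u) ->
  out_tree r A.
Proof.
move=> parent noroot reach v.
have walk_uniq p q : path (arc_rel A) r p -> path (arc_rel A) r q ->
    last r p = last r q -> p = q.
  elim/last_ind: p q => [|p y IHp] q; case/lastP: q => [|q z] //.
  - rewrite rcons_path last_rcons => _ /andP[_ zA] /= E.
    by have := noroot (last r q); rewrite {2}E [(_, _) \in A]zA.
  - rewrite rcons_path last_rcons => /andP[_ yA] _ /= E.
    by have := noroot (last r p); rewrite -{2}E [(_, _) \in A]yA.
  - rewrite !rcons_path !last_rcons => /andP[pp yA] /andP[pq zA] E.
    by rewrite -E in zA *; rewrite (IHp q) //; exact: parent yA zA.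
have reach_end : v \in tree_vertices r A -> connect (arc_rel A) r v.
  rewrite inE => /predU1P[->|/existsP[u /orP[uvA|vuA]]]; first exact: connect0.
    exact: connect_trans (reach _ _ uvA) (connect1 uvA).
  exact: reach vuA.
move=> /reach_end/connectP[p pp ->]; exists p; split=> // q [pq lq].
exact: walk_uniq.
Qed.

End OutTree.

(** * Disjoint paths as permutations *)

Section Reduction.
Variables (n : nat) (E : {set 'I_n * 'I_n}) (T : {set 'I_n}) (r : 'I_n).
Hypothesis rT : r \notin T.
Implicit Types (A : {set 'I_n * 'I_n}) (f g : 'I_n -> 'I_n).

Definition source (a : 'I_n) : 'I_n := if a \in T then r else a.

(** A terminal fixed by [f] is used: it is joined directly to the root. *)
Definition used (f : 'I_n -> 'I_n) : {set 'I_n} :=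
  [set a | (a != r) && ((a \in T) || (f a != a))].

Definition arc_of (f : 'I_n -> 'I_n) (a : 'I_n) := (source a, f a).

Definition arcs_of (f : 'I_n -> 'I_n) : {set 'I_n * 'I_n} :=
  [set arc_of f a | a in used f].

Definition disjoint_paths A : Prop :=
  [/\ out_tree r A, T \subset tree_vertices r A
    & forall u v, (u, v) \in A -> #|T :&: subtree A v| <= 1].

Lemma connect_first A u v : u != v -> connect (arc_rel A) u v ->
  exists2 c, (u, c) \in A & connect (arc_rel A) c v.
Proof.
move=> uv /connectP[[|c p] /= ]; first by move=> _ E'; rewrite E' eqxx in uv.
by case/andP=> uc pc ->; exists c => //; apply/connectP; exists p.
Qed.

(** A nonterminal other than the root that leads to a terminal points to the next vertex on the way,
    a terminal to the first vertex of its branch, and all others are fixed. The capacity bound makes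
    the terminal below an arc unique, whence injectivity. *)
Lemma paths_to_permutation A : disjoint_paths A ->
  exists f : 'I_n -> 'I_n, [/\ injective f, f r = r & arcs_of f \subset A].
Proof.
move=> [treeA TA capA].
pose busy a := (a != r) && [exists t in T, connect (arc_rel A) a t].
(* All terminals have the same source [r], so the arc alone does not identify [a]; the last clause
   records that [b] leads to [a] itself. *)
pose P a b := if busy a then
    (source a, b) \in A /\
    exists2 t, t \in T /\ connect (arc_rel A) b t & a \in T -> t = a
  else b = a.
have /fin_all_exists[f fP] : forall a, exists b, P a b.
  move=> a; rewrite /P; have [ba|_] := boolP (busy a); last by exists a.
  have /andP[ar /existsP[t /andP[tT at_]]] := ba.
  case aT: (a \in T); rewrite /source aT.
    have /treeA[p [[pp lp] _]] := subsetP TA _ aT.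
    have ra : connect (arc_rel A) r a by apply/connectP; exists p.
    have [|c rc ca] := connect_first _ ra; first by rewrite eq_sym.
    by exists c; split=> //; exists a.
  have [|c ac ct] := connect_first _ at_.
    by apply: contraFneq aT => ->.
  by exists c; split=> //; exists t.
have cap_eq u v t t' : (u, v) \in A -> t \in T -> t' \in T ->
    connect (arc_rel A) v t -> connect (arc_rel A) v t' -> t = t'.
  move=> /capA/card_le1_eqP h tT t'T vt vt'.
  by apply: h; rewrite !inE ?tT ?t'T ?vt ?vt'.
(* The image of a busy vertex is busy: it leads to a terminal and, as the end of an arc, is not the
   root. *)
have clash a b : busy a -> ~~ busy b -> f a <> b.
  move=> ba nb fab; move: (fP a); rewrite /P ba fab => -[sA [t [tT bt] _]].
  move: nb; rewrite /busy negb_and negbK => /orP[/eqP br|/existsP[]].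
    by rewrite br (negPf (out_tree_root _ treeA)) in sA.
  by exists t; rewrite tT.
have idle a : ~~ busy a -> f a = a.
  by move=> /negbTE na; move: (fP a); rewrite /P na.
exists f; split.
- move=> a b fab.
  have [ba|na] := boolP (busy a); have [bb|nb] := boolP (busy b).
  + move: (fP a) (fP b); rewrite /P ba bb -fab.
    move=> [aA [t [tT ct] ta]] [bA [t' [t'T ct'] t'b]].
    have := out_tree_parent treeA aA bA; rewrite /source.
    have [[ar _] [br _]] := (andP ba, andP bb).
    case aT: (a \in T); case bT: (b \in T) => //.
    * by rewrite -(ta aT) -(t'b bT) => _; exact: cap_eq aA tT t'T ct ct'.
    * by move=> E'; rewrite E' eqxx in br.
    * by move=> E'; rewrite E' eqxx in ar.
  + by case: (clash a b ba nb); rewrite fab idle.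
  + by case: (clash b a bb na); rewrite -fab idle.
  + by rewrite -(idle a na) -(idle b nb).
- by apply: idle; rewrite /busy eqxx.
apply/subsetP => _ /imsetP[a + ->]; rewrite inE => /andP[ar ua].
have ba : busy a.
  apply: contraLR ua => na; rewrite idle // eqxx orbF; move: na.
  by rewrite /busy ar; apply: contra => aT; apply/existsP; exists a;
    rewrite aT connect0.
by move: (fP a); rewrite /P ba => -[].
Qed.

Variables (c : 'I_n * 'I_n -> nat) (big : nat).
Hypothesis c_gt0 : forall e, e \in E -> 0 < c e.

Definition weight (a b : 'I_n) : nat :=
  if (a \notin T) && (a == b) then 0
  else if (source a, b) \in E then c (source a, b) else big.

Lemma arc_of_inj f : injective f -> injective (arc_of f).
Proof. by move=> finj a b [_ /finj]. Qed.

Lemma sum_weight f : injective f -> arcs_of f \subset E ->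
  \sum_(a | a != r) weight a (f a) = \sum_(e in arcs_of f) c e.
Proof.
move=> finj sub; rewrite big_imset /=; last by move=> a b _ _; exact: arc_of_inj.
rewrite (bigID (mem (used f))) /= [X in _ + X]big1 ?addn0 => [|a].
  apply: eq_big => [a|a /andP[_ au]]; first by rewrite inE andbA andbb.
  rewrite /weight; move: (au); rewrite inE => /andP[_ ua].
  have -> : (a \notin T) && (a == f a) = false.
    by rewrite eq_sym; apply/negbTE; rewrite negb_and negbK.
  by rewrite (subsetP sub) // imset_f.
rewrite inE => /andP[-> /=]; rewrite negb_or negbK => /andP[aT /eqP fa].
by rewrite /weight aT fa eqxx.
Qed.

Definition cheapest (f : 'I_n -> 'I_n) : Prop :=
  [/\ injective f, f r = r & arcs_of f \subset E] /\
  forall g : 'I_n -> 'I_n, injective g -> g r = r -> arcs_of g \subset E ->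
    \sum_(e in arcs_of f) c e <= \sum_(e in arcs_of g) c e.

(* Turning a cycle without terminals into fixed points would be cheaper. *)
Lemma cheapest_orbit f a : cheapest f -> a \in used f ->
  exists2 t, t \in T & fconnect f t a.
Proof.
move=> [[finj fr sub] fmin] au; pose reached b := [exists t in T, fconnect f t b].
have reached_f b : reached (f b) = reached b.
  by apply: eq_existsb => t; rewrite -same_fconnect1_r.
have [/existsP[t /andP[tT ta]]|na] := boolP (reached a); first by exists t.
pose g b := if reached b then f b else b.
have reachedT b : b \in T -> reached b.
  by move=> bT; apply/existsP; exists b; rewrite bT connect0.
have ginj : injective g.
  move=> b1 b2; rewrite /g.
  case R1: (reached b1); case R2: (reached b2) => //; first exact: finj.
    by move=> Eb; rewrite -Eb reached_f R1 in R2.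
  by move=> Eb; rewrite Eb reached_f R2 in R1.
have gr : g r = r by rewrite /g; case: ifP.
have gsub b : b \in used g -> b \in used f /\ g b = f b.
  rewrite !inE /g => /andP[->]; case R: (reached b) => //.
  by rewrite eqxx orbF => /reachedT; rewrite R.
have sub_g : arcs_of g \subset arcs_of f.
  apply/subsetP => _ /imsetP[b /gsub[bu gb] ->].
  by rewrite /arc_of gb; apply: imset_f.
have notin : arc_of f a \notin arcs_of g.
  apply/imsetP => -[b /gsub[bu gb]]; rewrite /arc_of gb => -[_ /finj ab].
  move: au gb; rewrite inE /g -ab (negPf na) =>
    /andP[_ /orP[/reachedT|/eqP fa /esym //]].
  by rewrite (negPf na).
have := fmin g ginj gr (subset_trans sub_g sub).
have a_in : arc_of f a \in arcs_of f by exact: imset_f.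
rewrite (big_setD1 _ a_in) /= leqNgt => /negP[].
apply: leq_trans (leq_add (c_gt0 (subsetP sub _ a_in)) (leqnn _)).
rewrite add1n ltnS; apply: leq_trans (_ :
  \sum_(e in arcs_of f :\ arc_of f a) c e <= _) => //.
rewrite [leqRHS](big_setID (arcs_of g)) /=.
rewrite (_ : (arcs_of f :\ arc_of f a) :&: arcs_of g = arcs_of g) ?leq_addr //.
by apply/setIidPr/subsetD1P.
Qed.

(** Going along a cycle from a terminal, one follows arcs and restarts at the root after each
    terminal, so everything on it is reached from [r]. By [cheapest_orbit] this covers all arcs, and
    injectivity of [f] gives unique parents. *)
Lemma cheapest_disjoint_paths f : cheapest f -> disjoint_paths (arcs_of f).
Proof.
move=> fcheap; have [[finj fr sub] _] := fcheap.
have arcP u v : reflect (exists a, [/\ a != r, (a \in T) || (f a != a), u = source a & v = f a])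
    ((u, v) \in arcs_of f).
  apply: (iffP imsetP) => [[a]|[a [ar ua -> ->]]].
    by rewrite inE => /andP[ar ua] [-> ->]; exists a.
  by exists a; rewrite // inE ar.
have noroot u : (u, r) \notin arcs_of f.
  by apply/arcP => -[a [ar _ _ rf]]; case/eqP: ar; apply: finj; rewrite fr.
have reach t k : t \in T -> connect (arc_rel (arcs_of f)) r (f (iter k f t)).
  move=> tT; elim: k => [|k IHk] /=.
    apply: connect1; apply/arcP; exists t; rewrite /source tT; split=> //.
    by apply: contraNneq rT => <-.
  set b := f _ in IHk *; have [->|fb] := eqVneq (f b) b; first exact: IHk.
  have br : b != r.
    apply: contra_neq fb => ->; exact: fr.
  case bT: (b \in T).
    by apply: connect1; apply/arcP; exists b; rewrite /source bT.
  apply: connect_trans IHk (connect1 _); apply/arcP; exists b.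
  by rewrite /source bT br fb.
have reach_src u v : (u, v) \in arcs_of f -> connect (arc_rel (arcs_of f)) r u.
  case/arcP => a [ar ua -> _]; rewrite /source; case aT: (a \in T) => //.
  have [|t tT] := cheapest_orbit fcheap (a := a); first by rewrite inE ar.
  move=> /iter_findex; case: (findex _ _ _) => [|k] /= E'.
    by rewrite -E' tT in aT.
  by rewrite -E'; exact: reach.
have treef : out_tree r (arcs_of f).
  apply: out_tree_intro => // u u' v /arcP[a [_ _ -> ->]] /arcP[b [_ _ -> /finj ->]].
  by [].
split=> //.
- apply/subsetP => t tT; have [a fa] : exists a, f a = t.
    by exists (finv f t); rewrite f_finv.
  have ta : (source a, t) \in arcs_of f.
    apply/arcP; exists a; rewrite fa; split=> //.
      by apply: contraNneq rT => ar; rewrite -fr -ar fa.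
    by case aT: (a \in T) => //=; apply: contraFneq aT => <-.
  by have [] := tree_vertices_arc r ta.
(* Outside the root, out-degrees are at most 1 and terminals are sinks. *)
have out u v : (u, v) \in arcs_of f -> u != r -> u \notin T /\ v = f u.
  case/arcP => a [ar ua ->
    ->]; rewrite /source; case aT: (a \in T); first by rewrite eqxx.
  by rewrite aT.
have uniq_end p v t t' : v != r -> path (arc_rel (arcs_of f)) v p -> last v p = t ->
    t \in T -> t' \in T -> connect (arc_rel (arcs_of f)) v t' -> t = t'.
  elim: p v => [|y p IHp] v vr /=.
    move=> _ <- vT t'T /connectP[[|z q] /= ]; first by move=> _ ->.
    by case/andP=> /out/(_ vr)[]; rewrite vT.
  case/andP=> vy pp lp tT t'T; have [vT yE] := out _ _ vy vr.
  have yr : y != r by apply: contraTneq vy => ->; exact: noroot.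
  move=> /connectP[[|z q] /= ]; first by move=> _ Ev; rewrite -Ev t'T in vT.
  case/andP=> /out/(_ vr)[_ zE] pq Et'; apply: (IHp y) => //.
  by apply/connectP; exists q; rewrite yE -zE.
move=> u v uv; apply/card_le1_eqP => t t';
  rewrite !inE => /andP[tT vt] /andP[t'T vt'].
have vr : v != r by apply: contraTneq uv => ->; exact: noroot.
by have /connectP[p pp /esym lp] := vt; apply/esym; apply: (uniq_end p v).
Qed.

End Reduction.


(** * The algorithm *)

Import Order.TTheory GRing.Theory Num.Theory.

(* [(vertices, (edges, (terminals, root)))], an edge being
   [((u, v), ((numerator, denominator), capacity))]. *)
Notation input := (seq nat * (seq ((nat * nat) * ((nat * nat) * nat)) *
                              (seq nat * nat)))%type.

Definition vertex_count (x : input) : nat := \sum_(v <- x.1) 1.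

(* [length] times the product of all denominators *)
Definition scaled_length (x : input) (e : nat * nat) : nat :=
  \prod_(f <- x.2.1) (if f.1 == e then f.2.1.1 else f.2.1.2).

(* The added 1 makes every arc cost something; the factor keeps the added
   total below one unit of length. *)
Definition arc_cost (x : input) (e : nat * nat) : nat :=
  (vertex_count x + 1) * scaled_length x e + 1.

(** Exceeds the cost of any set of existing arcs, so that a single missing arc costs more than every
    feasible solution. *)
Definition big_cost (x : input) : nat :=
  \sum_(f <- x.2.1) arc_cost x f.1 + 1.

Definition source_nat (x : input) (a : nat) : nat :=
  if a \in x.2.2.1 then x.2.2.2 else a.

Definition weight_nat (x : input) (a b : nat) : nat :=
  if (a \notin x.2.2.1) && (a == b) then 0
  else if has (fun f => f.1 == (source_nat x a, b)) x.2.1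
       then arc_cost x (source_nat x a, b) else big_cost x.

Definition non_root (x : input) : seq nat := [seq v <- x.1 | v != x.2.2.2].

Definition tree_of_table (x : input) (t : table) : option (seq (nat * nat)) :=
  if all (fun a => weight_nat x a (lookup t a) + 1 <= big_cost x) (non_root x)
  then Some [seq (source_nat x a, lookup t a) |
             a <- [seq a <- non_root x | (a \in x.2.2.1) || (lookup t a != a)]]
  else None.

Definition solve (x : input) : option (seq (nat * nat)) :=
  tree_of_table x (hungarian (non_root x) (weight_nat x)).

Lemma pt_eq_pair {A : Type} {eA : Enc A} (f g : A -> nat * nat) :
  polytime f -> polytime g -> polytime (fun x => f x == g x).
Proof.
move=> hf hg.
apply: (pt_ext (f := fun x => ((f x).1 == (g x).1) && ((f x).2 == (g x).2))).
  by move=> x; case: (f x) (g x) => [a b] [c d].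
by pt.
Qed.

Ltac pt_more ::= first [simple apply pt_mem | simple apply pt_lookup
  | simple apply pt_eq_pair].

Section PTSolve.
Context {A : Type} {eA : Enc A}.
Variable (x : A -> input).
Hypothesis hx : polytime x.

Lemma pt_scaled_length (e : A -> nat * nat) :
  polytime e -> polytime (fun z => scaled_length (x z) (e z)).
Proof. by move=> he; unfold scaled_length; pt. Qed.

Lemma pt_vertex_count : polytime (fun z => vertex_count (x z)).
Proof. by unfold vertex_count; pt. Qed.

Lemma pt_source_nat (a : A -> nat) : polytime a ->
  polytime (fun z => source_nat (x z) (a z)).
Proof. by move=> ha; unfold source_nat; pt. Qed.

Lemma pt_non_root : polytime (fun z => non_root (x z)).
Proof. by unfold non_root; pt. Qed.

End PTSolve.

Ltac pt_more ::= first [simple apply pt_mem | simple apply pt_lookup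
  | simple apply pt_eq_pair | simple apply pt_scaled_length
  | simple apply pt_vertex_count | simple apply pt_source_nat
  | simple apply pt_non_root].

Lemma pt_arc_cost {A : Type} {eA : Enc A} (x : A -> input) (e : A -> nat * nat) :
  polytime x -> polytime e -> polytime (fun z => arc_cost (x z) (e z)).
Proof. by move=> hx he; unfold arc_cost; pt. Qed.

Ltac pt_more ::= first [simple apply pt_mem | simple apply pt_lookup
  | simple apply pt_eq_pair | simple apply pt_scaled_length
  | simple apply pt_vertex_count | simple apply pt_source_nat
  | simple apply pt_non_root | simple apply pt_arc_cost].

Lemma pt_big_cost {A : Type} {eA : Enc A} (x : A -> input) :
  polytime x -> polytime (fun z => big_cost (x z)).
Proof. by move=> hx; unfold big_cost; pt. Qed.

Lemma pt_weight_nat {A : Type} {eA : Enc A} (x : A -> input) (a b : A -> nat) :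
  polytime x -> polytime a -> polytime b ->
    polytime (fun z => weight_nat (x z) (a z) (b z)).
Proof.
move=> hx ha hb; unfold weight_nat.
by have := pt_big_cost hx => hbig; pt.
Qed.

Lemma pt_solve : polytime solve.
Proof.
apply: (pt_comp2 (h := tree_of_table) (f := id)).
- unfold tree_of_table; pt; last by apply: pt_big_cost; pt.
  by apply: pt_weight_nat; pt.
- exact: pt_id.
- by apply: pt_hungarian; [pt|apply: pt_weight_nat; pt].
Qed.

Lemma enc_seq_map (S T : Type) (enc_T : T -> tree) (h : S -> T) (s : seq S) :
  enc_seq enc_T (map h s) = enc_seq (fun a => enc_T (h a)) s.
Proof. by elim: s => //= a s ->. Qed.

(** * Correctness on encoded networks *)

Section Correctness.
Variable N : network.
Local Notation n := (nverts N).
Local Notation r := (root N).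
Local Notation T := (terminals N).
Local Notation V := 'I_n.

Definition arc_nat (e : V * V) : nat * nat := (val e.1, val e.2).

Definition edge_data (e : V * V) : (nat * nat) * ((nat * nat) * nat) :=
  (arc_nat e, ((`|numq (len e)|%N, `|denq (len e)|%N), cap e)).

Definition network_input : input :=
  (map val (enum V),
   (map edge_data (enum (edges N)), (map val (enum T), val r))).

Local Notation x := network_input.

Lemma enc_network_input : ml_encode N = enc x.
Proof.
rewrite /enc /enc_pair_inst /= /ml_encode /enc /enc_seq_inst.
by rewrite !enc_seq_map.
Qed.

Lemma arc_nat_inj : injective arc_nat.
Proof. by move=> [a b] [c d] [/val_inj-> /val_inj->]. Qed.

Lemma mem_terminals (a : V) : (val a \in x.2.2.1) = (a \in T).
Proof. by rewrite /= mem_map ?mem_enum //; exact: val_inj. Qed.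

Lemma source_natE (a : V) : source_nat x (val a) = val (source T r a).
Proof. by rewrite /source_nat mem_terminals /source; case: ifP. Qed.

Lemma has_arc (e : V * V) : has (fun f => f.1 == arc_nat e) x.2.1 = (e \in edges N).
Proof.
apply/hasP/idP => [[_ /mapP[e' + ->] /eqP/arc_nat_inj <-]|eE].
  by rewrite mem_enum.
by exists (edge_data e); rewrite ?eqxx //; apply: map_f; rewrite mem_enum.
Qed.

Lemma mem_non_root k : reflect (exists2 a :
  V, a != r & val a = k) (k \in non_root x).
Proof.
rewrite mem_filter; apply: (iffP andP) => [[kr /mapP[a _ ak]]|[a ar <-]].
  by exists a => //; apply: contraNneq kr => ar; rewrite ak ar.
by split; rewrite //= map_f ?mem_enum.
Qed.

Definition cost_of (e : V * V) : nat := arc_cost x (arc_nat e).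

Lemma weight_natE (a b : V) :
  weight_nat x (val a) (val b) = weight (edges N) T r cost_of (big_cost x) a b.
Proof.
rewrite /weight_nat mem_terminals source_natE.
by rewrite (has_arc (source T r a, b)).
Qed.

Lemma cost_of_gt0 e : 0 < cost_of e.
Proof. by rewrite /cost_of /arc_cost addn1. Qed.

Lemma big_costE : big_cost x = \sum_(e in edges N) cost_of e + 1.
Proof. by rewrite /big_cost big_map big_enum. Qed.

Lemma sum_non_root (F : nat -> nat) :
  \sum_(k <- non_root x) F k = \sum_(a : V | a != r) F (val a).
Proof. by rewrite big_filter big_map big_enum_cond. Qed.

Definition denominator : nat := \prod_(e in edges N) `|denq (len e)|%N.

Lemma scaled_lengthE (e : V * V) : e \in edges N -> (0 <= len e)%R ->
  ((scaled_length x (arc_nat e))%:R = denominator%:R * len e :> rat)%R.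
Proof.
move=> eE len_ge0; rewrite /scaled_length /denominator big_map big_enum.
rewrite (bigD1 e) //= eqxx [in RHS](bigD1 e) //=.
under eq_bigr => f /andP[_ /negPf fe] do rewrite (inj_eq arc_nat_inj) fe.
rewrite !natrM mulrAC; congr (_ * _)%R.
rewrite !pmulrn absz_denq gez0_abs ?numq_ge0 //.
by rewrite numqE mulrC.
Qed.

Lemma denominator_gt0 : 0 < denominator.
Proof. by rewrite prodn_gt0 // => e; rewrite absz_gt0 denq_neq0. Qed.

(** The cost of a set is [n + 1] times its scaled length [W] plus its number of arcs. A larger [W S]
    would add at least [n + 1], which the at most [n] arcs of [S'] cannot make up for. *)
Lemma cheaper_shorter (S S' : {set V * V}) :
  (forall e, e \in edges N -> (0 <= len e)%R) ->
  S \subset edges N -> S' \subset edges N -> #|S'| <= n ->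
  \sum_(e in S) cost_of e <= \sum_(e in S') cost_of e ->
  (total_length S <= total_length S')%R.
Proof.
move=> len_ge0 SE SE' leS'.
pose W (S0 : {set V * V}) := \sum_(e in S0) scaled_length x (arc_nat e).
have WE (S0 : {set V * V}) : S0 \subset edges N ->
    ((W S0)%:R = denominator%:R * total_length S0 :> rat)%R.
  move=> sub; rewrite natr_sum /total_length mulr_sumr.
  by apply: eq_bigr => e /(subsetP sub) eE; rewrite scaled_lengthE ?len_ge0.
have CE (S0 : {set V * V}) : \sum_(e in S0) cost_of e = (n + 1) * W S0 + #|S0|.
  rewrite -sum1_card big_distrr -big_split; apply: eq_bigr => e _ /=.
  by rewrite /cost_of /arc_cost /vertex_count big_map big_enum sum1_card card_ord.
rewrite !CE => le_cost.
have leW : W S <= W S'.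
  rewrite leqNgt; apply/negP => ltW.
  have := leq_mul (leqnn (n + 1)) ltW; rewrite mulnS; lia.
rewrite -(ler_pM2l (x := denominator%:R)%R) ?ltr0n ?denominator_gt0 //.
by rewrite -!WE // ler_nat.
Qed.

Hypothesis len_ge0 : forall e, e \in edges N -> (0 <= len e)%R.
Hypothesis unit_cap : forall e, e \in edges N -> cap e = 1.
Hypothesis rT : r \notin T.

Lemma feasibleE (S : {set V * V}) :
  feasible S <-> S \subset edges N /\ disjoint_paths T r S.
Proof.
split=> [[sub tree TS capS]|[sub [tree TS capS]]].
  split=> //; split=> // u v uv; have uvE := subsetP sub _ uv.
  by rewrite -(unit_cap uvE) capS.
by split=> // u v uv; rewrite (unit_cap (subsetP sub _ uv)) (capS u).
Qed.

Lemma card_arcs_of (f : V -> V) : #|arcs_of T r f| <= n.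
Proof.
apply: leq_trans (leq_imset_card _ _) _.
by apply: leq_trans (max_card _) _; rewrite card_ord.
Qed.

Lemma cost_sum_leq (S S' : {set V * V}) : S \subset S' ->
  \sum_(e in S) cost_of e <= \sum_(e in S') cost_of e.
Proof.
move=> sub; rewrite [leqRHS](big_setID S) /=.
by move/setIidPr: sub => ->; exact: leq_addr.
Qed.

Section Permutation.
Variable t : table.
Hypothesis t_perm : permutes (non_root x) (lookup t).

Definition perm_of_table (a : V) : V :=
  if a == r then r else insubd r (lookup t (val a)).
Local Notation f := perm_of_table.

Lemma val_perm_of_table a : a != r -> val (f a) = lookup t (val a).
Proof.
move=> ar; rewrite /f (negPf ar).
have /(t_perm.1 _) /mem_non_root[b _ <-] : val a \in non_root x.
  by apply/mem_non_root; exists a.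
by rewrite valKd.
Qed.

Lemma perm_of_table_root : f r = r.
Proof. by rewrite /f eqxx. Qed.

Lemma perm_of_table_neq a : a != r -> f a != r.
Proof.
move=> ar; have /(t_perm.1 _) /mem_non_root[b br] : val a \in non_root x.
  by apply/mem_non_root; exists a.
by rewrite -val_perm_of_table // => /val_inj <-.
Qed.

Lemma perm_of_table_inj : injective f.
Proof.
move=> a b; have [->|ar] := eqVneq a r; have [->|br] := eqVneq b r => //.
- by move=> E; have := perm_of_table_neq br; rewrite -E perm_of_table_root eqxx.
- by move=> E; have := perm_of_table_neq ar; rewrite E perm_of_table_root eqxx.
move=> /(congr1 val); rewrite !val_perm_of_table // => E.
by apply/val_inj/t_perm.2 => //; apply/mem_non_root; [exists a|exists b].
Qed.

Lemma sum_table :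
  \sum_(k <- non_root x) weight_nat x k (lookup t k) =
  \sum_(a | a != r) weight (edges N) T r cost_of (big_cost x) a (f a).
Proof.
rewrite sum_non_root; apply: eq_bigr => a ar.
by rewrite -val_perm_of_table // weight_natE.
Qed.

End Permutation.
Lemma uniq_non_root : uniq (non_root x).
Proof. by rewrite filter_uniq // map_inj_uniq ?enum_uniq //; exact: val_inj. Qed.

Lemma perm_on_lift (g : V -> V) : injective g -> g r = r ->
  permutes (non_root x) (fun k => val (g (insubd r k))).
Proof.
move=> ginj gr; split=> [k /mem_non_root[a ar <-]|].
  rewrite valKd; apply/mem_non_root; exists (g a) => //.
  by apply: contra_neq ar => ga; apply: ginj; rewrite gr.
move=> _ _ /mem_non_root[a _ <-] /mem_non_root[b _ <-].
by rewrite !valKd => /val_inj/ginj ->.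
Qed.

Lemma sum_lift (g : V -> V) :
  \sum_(k <- non_root x) weight_nat x k (val (g (insubd r k))) =
  \sum_(a | a != r) weight (edges N) T r cost_of (big_cost x) a (g a).
Proof.
by rewrite sum_non_root; apply: eq_bigr => a ar; rewrite valKd weight_natE.
Qed.

Lemma solve_correct : ml_correct_output N (enc (solve x)).
Proof.
have [] := @hungarianP (non_root x) (weight_nat x) uniq_non_root.
rewrite /solve; move: (hungarian _ _) => t t_perm t_min.
set f := perm_of_table t.
have finj : injective f := perm_of_table_inj t_perm.
have fr : f r = r := perm_of_table_root t.
have sumf := sum_table t_perm; rewrite -/f in sumf.
have f_min g : injective g -> g r = r ->
    \sum_(a | a != r) weight (edges N) T r cost_of (big_cost x) a (f a) <=
    \sum_(a | a != r) weight (edges N) T r cost_of (big_cost x) a (g a).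
  move=> ginj gr; rewrite -sumf -sum_lift.
  exact: t_min (perm_on_lift ginj gr).
rewrite /tree_of_table; case: allP => [real|no_real]; last first.
  (* A feasible tree would yield a permutation cheaper than [big_cost], so no entry of the optimal
     one could reach that cost. *)
  left; split=> // S /feasibleE[SE /paths_to_permutation[g [ginj gr gS]]].
  apply: no_real => _ /mem_non_root[a ar <-];
    rewrite -val_perm_of_table // weight_natE.
  rewrite -/f addn1; apply: leq_ltn_trans (_ : \sum_(a | a != r)
    weight (edges N) T r cost_of (big_cost x) a (f a) < _).
    by rewrite (bigD1 a) //= leq_addr.
  have gE := subset_trans gS SE.
  apply: leq_ltn_trans (f_min g ginj gr) _;
    rewrite (sum_weight cost_of (big_cost x) ginj gE) big_costE addn1 ltnS.
  exact: cost_sum_leq gE.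
have fE : arcs_of T r f \subset edges N.
  apply/subsetP => _ /imsetP[a au ->]; apply/idPn => notE.
  move: au; rewrite inE => /andP[ar ua].
  have : val a \in non_root x by apply/mem_non_root; exists a.
  move=> /real; rewrite -val_perm_of_table // weight_natE -/f /weight.
  rewrite ifN; first by rewrite (negPf notE) addn1 ltnn.
  by rewrite negb_and negbK eq_sym.
have fcheap : cheapest (edges N) T r cost_of f.
  split=> // g ginj gr gE.
  by rewrite -(sum_weight cost_of (big_cost x) finj fE) -(sum_weight cost_of (big_cost x) ginj gE) f_min.
right; exists [seq arc_of T r f a | a <- [seq a <- enum V | a \in used T r f]].
have setE : [set e in [seq arc_of T r f a | a <- [seq a <- enum V | a \in used T r f]]] =
    arcs_of T r f.
  apply/setP => e; rewrite inE; apply/mapP/imsetP => -[a au ->]; exists a => //.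
    by move: au; rewrite mem_filter => /andP[].
  by rewrite mem_filter au mem_enum.
have listE : [seq (source_nat x k, lookup t k) |
      k <- [seq k <- non_root x | (k \in x.2.2.1) || (lookup t k != k)]] =
    map arc_nat [seq arc_of T r f a | a <- [seq a <- enum V | a \in used T r f]].
  rewrite /non_root -filter_predI filter_map -!map_comp.
  rewrite (eq_filter (a2 := [in used T r f])) => [|a].
    apply/eq_in_map => a; rewrite mem_filter inE => /andP[/andP[ar _] _].
    by rewrite /= source_natE -val_perm_of_table.
  rewrite !inE /= andbC; have [->|ar] := eqVneq a r; first by rewrite eqxx.
  rewrite -[X in _ && (X || _)]/(val a \in x.2.2.1) mem_terminals.
  by rewrite -val_perm_of_table // ar.
split.
- by rewrite listE -(enc_seq_map (fun e :
    nat * nat => Node (enc_nat e.1) (enc_nat e.2)) arc_nat).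
- rewrite map_inj_uniq; last by move=> a b [_ /finj].
  by apply: filter_uniq; exact: enum_uniq.
rewrite setE; split.
  apply/feasibleE; split=> //.
  have c_gt0 e : e \in edges N -> 0 < cost_of e by rewrite cost_of_gt0.
  exact (cheapest_disjoint_paths rT c_gt0 fcheap).
move=> S /feasibleE[SE /paths_to_permutation[g [ginj gr gS]]].
have gE := subset_trans gS SE.
(* The comparison goes through [g]: costs are compared between permutations, and [S] contains the
   arcs of [g], so it is no shorter than they are. *)
apply: (le_trans (y := total_length (arcs_of T r g))).
  apply: cheaper_shorter => //; first exact: card_arcs_of.
  exact: fcheap.2.
rewrite /total_length [leRHS](big_setID (arcs_of T r g)) /=.
move/setIidPr: (gS) => ->; rewrite lerDl sumr_ge0 // => e.
by rewrite inE => /andP[_ /(subsetP SE)]; exact: len_ge0.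
Qed.

End Correctness.

(** The command is taken at base 0, the variable of input and output. The factor [2 ^ d] comes from
    [n.+1 <= 2 * n], valid as trees have nonzero size. *)
Lemma pt_polytime (P : problem) (A B : Type) (eA : Enc A) (eB : Enc B) (f : A -> B)
    (h : instance P -> A) :
  polytime f -> (forall I, admissible I -> encode I = enc (h I)) ->
  (forall I, admissible I -> correct_output I (enc (f (h I)))) ->
  polytime_solvable P.
Proof.
move=> /(_ 0)[c [p [[_ [a [d le_p]]] hc]]] hE f_correct.
exists c, (a * 2 ^ d), d => I adm.
have [|s [k [exec_c s0 _ le_k]]] := hc (update (fun=> Leaf) 0 (encode I)) (h I).
  by rewrite -hE.
exists (enc (f (h I))), k; split; [by exists s| |exact: f_correct].
apply: leq_trans le_k (leq_trans (le_p _) _); rewrite -hE //.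
apply: leq_trans _ (leq_addr _ _); rewrite -mulnA -expnMn leq_mul2l.
have : 0 < tsize (encode I) by exact: tsize_gt0.
case: (d) => [|d'] t_gt0; first by rewrite !expn0 orbT.
by rewrite leq_exp2r // mul2n -addnn -addn1 leq_add2l t_gt0 orbT.
Qed.

(** An undirected edge is given by both its orientations, so one algorithm on arcs serves both kinds
    of graphs. *)
Lemma ml_polytime g :
  polytime_solvable (restrict (P := ML_CAP_STEINER_TREE g) unit_capacities).
Proof.
pose P := restrict (P := ML_CAP_STEINER_TREE g) unit_capacities.
apply: (@pt_polytime P _ _ _ _ solve network_input pt_solve) => N.
  by move=> _; exact: enc_network_input.
by case=> [[_ _ _ rT posE] unitN]; apply: solve_correct => // e /posE[].
Qed.

Theorem theorem4p1 :
  polytime_solvable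
    (restrict (P := ML_CAP_STEINER_TREE Undirected) unit_capacities) /\
  polytime_solvable
    (restrict (P := ML_CAP_STEINER_TREE Directed) unit_capacities).
Proof. by split; exact: ml_polytime. Qed.
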